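(* Let $G$ be a locally compact second countable group with Kazhdan's property (T), and let $\Lambda$ be a $\star$-approximate lattice in $G$. Then the subgroup $\langle\Lambda\rangle$ generated by $\Lambda$ is finitely generated.
   Context: For subsets $X,Y$ of a group $G$, $XY=\{xy : x\in X,y\in Y\}$ and $X^{-1}=\{x^{-1}:x\in X\}$. An approximate subgroup of $G$ is a subset $X\ni e$ with $X=X^{-1}$ and $X^2\subset FX$ for some finite $F\subset G$. For a locally compact second countable group $G$, a subset $X$ is uniformly discrete if $e$ is isolated in $X^{-1}X$. $\mathcal{C}(G)$ is the set of closed subsets of $G$ with the Chabauty--Fell topology, generated by the sets $U_K=\{C : C\cap K=\emptyset\}$ ($K\subset G$ compact) and $U^V=\{C: C\cap V\neq\emptyset\}$ ($V\subset G$ open); it is a compact metrizable $G$-space under $(g,X)\mapsto gX$. The extended invariant hull of a closed subset $X_0$ is the closed $G$-invariant set $\Omega^{ext}_{X_0}=\{X\in\mathcal{C}(G): X^{-1}X\subset\overline{X_0^{-1}X_0}\}$. A Borel probability measure $\nu$ on it is proper if $\nu(\{\emptyset\})=0$. A $\star$-approximate lattice in $G$ is a uniformly discrete approximate subgroup $\Lambda$ such that $\Omega^{ext}_\Lambda$ carries a proper $G$-invariant Borel probability measure. *)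

(* Defs.v *)
From HB Require Import structures.
From mathcomp Require Import all_boot all_order all_algebra.
From mathcomp Require Import all_classical all_reals all_analysis.
From mathcomp Require Import complex.
Import Order.TTheory GRing.Theory Num.Theory.
Import numFieldNormedType.Exports.

Set Implicit Arguments.
Unset Strict Implicit.
Unset Printing Implicit Defensive.

Local Open Scope classical_set_scope.
Local Open Scope ring_scope.

HB.mixin Record isTopologicalGroup G & Topological G & Group G := {
  mulg_continuous : continuous (fun x : G * G => x.1 * x.2)%g ;
  invg_continuous : continuous (fun x : G => x^-1)%g
}.

#[short(type="topologicalGroupType")]
HB.structure Definition TopologicalGroup :=
  {G of Topological G & Group G & isTopologicalGroup G}.

(* Locally compact groups are Hausdorff by the usual convention, which
   locally_compact does not include. *)
Definition lcsc_group (G : topologicalGroupType) : Prop :=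
  [/\ hausdorff_space G, locally_compact [set: G] & @second_countable G].

Section Subsets.
Variable G : groupType.
Implicit Types X Y : set G.

Definition mulgset X Y : set G := [set x * y | x in X & y in Y]%g.

Definition invgset X : set G := [set x^-1 | x in X]%g.

Definition approximate_subgroup X : Prop :=
  [/\ X 1%g, X = invgset X &
      exists2 F : set G, finite_set F & mulgset X X `<=` mulgset F X].

Definition is_subgroup (H : set G) : Prop :=
  [/\ H 1%g, forall x y, H x -> H y -> H (x * y)%g
    & forall x, H x -> H (x^-1)%g].

Definition subgroup_generated X : set G := smallest is_subgroup X.

Definition finitely_generated (H : set G) : Prop :=
  exists2 S : set G, finite_set S & subgroup_generated S = H.

End Subsets.

Section Kazhdan.
Variable R : realType.

(* The inner product is linear in the first and conjugate-linear in the second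
   argument; the norm of a complex normed module takes its values in R[i]. *)
Record hilbertSpace := HilbertSpace {
  hilbert_sort :> completeNormedModType R[i] ;
  inner : {dot hilbert_sort for Num.conj} ;
  inner_norm : forall v : hilbert_sort, inner v v = `|v| ^+ 2
}.

Definition unitary (H : hilbertSpace) (U : H -> H) : Prop :=
  [/\ linear U, set_surj [set: H] [set: H] U
    & forall v w : H, inner H (U v) (U w) = inner H v w].

Definition unitary_representation (G : topologicalGroupType)
    (H : hilbertSpace) (pi : G -> H -> H) : Prop :=
  [/\ forall g, unitary (pi g),
      forall v, pi 1%g v = v,
      forall g h v, pi (g * h)%g v = pi g (pi h v)
    & forall v, continuous (fun g => pi g v)].

Definition property_T (G : topologicalGroupType) : Prop :=
  exists (Q : set G) (eps : R), [/\ compact Q, 0 < eps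
    & forall (H : hilbertSpace) (pi : G -> H -> H),
        unitary_representation pi ->
        (exists2 v : H, v != 0 &
           forall g, Q g -> `|pi g v - v| < eps%:C%C * `|v|) ->
        exists2 v : H, v != 0 & forall g, pi g v = v].

End Kazhdan.

Record closedSet (T : topologicalType) := ClosedSet {
  closed_set :> set T ;
  closed_setP : closed closed_set
}.

Section ChabautyFell.
Variable T : topologicalType.

HB.instance Definition _ := gen_eqMixin (closedSet T).
HB.instance Definition _ := gen_choiceMixin (closedSet T).
HB.instance Definition _ :=
  isPointed.Build (closedSet T) (ClosedSet (@closed0 T)).

Definition fell_miss (K : set T) : set (closedSet T) :=
  [set C | (C : set T) `&` K = set0].

Definition fell_hit (V : set T) : set (closedSet T) :=
  [set C | (C : set T) `&` V !=set0].

Definition fell_subbase : set (set (closedSet T)) :=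
  [set fell_miss K | K in compact] `|` [set fell_hit V | V in open].

HB.instance Definition _ :=
  isSubBaseTopological.Build (closedSet T) fell_subbase id.

End ChabautyFell.

Section Hull.
Variable G : topologicalGroupType.
Implicit Types g : G.

Definition translate g (X : set G) : set G := [set g * x | x in X]%g.

Lemma translate_closed g (X : set G) : closed X -> closed (translate g X).
Proof.
move=> cX; have -> : translate g X = (fun x => g^-1 * x)%g @^-1` X.
  apply/seteqP; split=> [_ [x Xx <-]|x /= Xx]; first by rewrite /= mulKg.
  by exists (g^-1 * x)%g => //; rewrite mulVKg.
apply: preimage_closed cX => x _.
apply: (@continuous_comp _ _ _ (fun x : G => (g^-1, x)%g)
  (fun z : G * G => z.1 * z.2)%g); last exact: mulg_continuous.
by apply: cvg_pair; [exact: cvg_cst | exact: cvg_id].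
Qed.

Definition ltrans g (X : closedSet G) : closedSet G :=
  ClosedSet (@translate_closed g X (@closed_setP _ X)).

Definition invmul (X : set G) : set G := mulgset (invgset X) X.

Definition in_ext_hull (X0 X : set G) : Prop :=
  invmul X `<=` closure (invmul X0).

Lemma in_ext_hull0 (X0 : set G) : in_ext_hull X0 set0.
Proof. by move=> _ [_ [? []]]. Qed.

Lemma invmul_translate g (X : set G) :
  invmul (translate g X) = invmul X.
Proof.
apply/seteqP; split=> [_ [_ [_ [x Xx <-] <-] [_ [y Xy <-] <-]]
                      |_ [_ [x Xx <-] [y Xy <-]]].
  exists (x^-1)%g; first by exists x.
  by exists y => //; rewrite invgM -!mulgA mulKg.
exists ((g * x)^-1)%g; first by exists (g * x)%g => //; exists x.
by exists (g * y)%g; [exists y | rewrite invgM -!mulgA mulKg].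
Qed.

Lemma in_ext_hull_ltrans (X0 : set G) g (X : closedSet G) :
  in_ext_hull X0 X -> in_ext_hull X0 (ltrans g X).
Proof. by rewrite /in_ext_hull /= invmul_translate. Qed.

(* The extended invariant hull, as a subspace of the Chabauty-Fell space. *)
Record ext_hull (X0 : set G) := ExtHull {
  hull_set :> closedSet G ;
  hull_setP : in_ext_hull X0 hull_set
}.

Definition hull_act (X0 : set G) g (X : ext_hull X0) : ext_hull X0 :=
  ExtHull (@in_ext_hull_ltrans X0 g X (@hull_setP _ X)).

Section Topology.
Variable X0 : set G.

HB.instance Definition _ := gen_eqMixin (ext_hull X0).
HB.instance Definition _ := gen_choiceMixin (ext_hull X0).
HB.instance Definition _ := isPointed.Build (ext_hull X0)
  (@ExtHull X0 (ClosedSet (@closed0 G)) (@in_ext_hull0 X0)).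
HB.instance Definition _ := Topological.copy (ext_hull X0)
  (initial_topology (@hull_set X0)).

End Topology.

Definition borel_hull (X0 : set G) := g_sigma_algebraType (@open (ext_hull X0)).

End Hull.

Section StarApproximateLattice.
Variables (R : realType) (G : topologicalGroupType).
Implicit Types X : set G.

Definition uniformly_discrete X : Prop := isolated (invmul X) 1%g.

Definition proper_measure X (nu : probability (borel_hull X) R) : Prop :=
  nu [set Y : ext_hull X | (Y : set G) = set0] = 0%E.

Definition invariant_measure X (nu : probability (borel_hull X) R) : Prop :=
  forall (g : G) (A : set (borel_hull X)), measurable A ->
    nu (@hull_act G X g @^-1` A) = nu A.

Definition star_approximate_lattice X : Prop :=
  [/\ uniformly_discrete X, approximate_subgroup X
    & exists nu : probability (borel_hull X) R,
        proper_measure nu /\ invariant_measure nu].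

End StarApproximateLattice.

(* Main.v *)
Require Import Defs.
From HB Require Import structures.
From mathcomp Require Import finmap.
From mathcomp Require Import all_boot all_order all_algebra.
From mathcomp Require Import all_classical all_reals all_analysis.
From mathcomp Require Import complex measurable_realfun.
From mathcomp Require Import ring lra.
Import Order.TTheory GRing.Theory Num.Theory.
Import numFieldNormedType.Exports.

Set Implicit Arguments.
Unset Strict Implicit.
Unset Printing Implicit Defensive.

(** Let [nu] be the invariant proper probability on the hull of [L]. A member
[P] of the hull satisfies [P^-1 P <= L L], and [L L] is locally finite, so [P]
is a discrete set of points.

Fix a compact set [M] and let [H] be the subgroup generated by the finite
intersection of [L L] with [M^-1 M]. Call points [x], [y] of [P] equivalent when
[x^-1 y] is in [H]; this relation is preserved by left translations, and all the
points of [P] in [M] lie in one class. The functions [w (P, x)] that depend only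
on the class of [x] in [P], with the squared norm [sqn w] (the [nu]-mean of the sum of [w ^+ 2]
over the classes of [P]), form a real Hilbert space with an orthogonal action
of [G]. Let [phi] be a bump function equal to 1 on a compact set [K], and let
[class_max (P, x)] be the supremum of [phi] over the class of [x]. If [M]
contains the support of [phi] and its translates by the Kazhdan set, then a
translate of [class_max] by an element [g] of the Kazhdan set differs from
[class_max] only at those [P] that miss [K] or [g K], and for such a [P] only
at one class ([sqn_almost_invariant]). As [nu] is proper, these [P] have small
measure when [K] is large. Property (T) then gives an invariant [w] of positive
norm.

The mass [wmass A], the [nu]-mean of the sum of [w ^+ 2] over the points of [P]
in [A], is a nonzero left-invariant measure, finite on compact sets. Right
translations multiply such a measure by a character, so the masses of [A l] and
[A l^-1] have product [wmass A ^+ 2] ([haar_mulrV]). On the other hand, let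
[l_1], ..., [l_n] in [L] lie in distinct right cosets of [H]. When [x] runs
over one class of [P], the points [x l_k] are pairwise distinct, and they lie
in [P L], which has a bounded number [N] of points in the compact set [A].
Summing over the classes, the masses of the sets [A l_k^-1] add up to at most
[N * sqn w] ([wmass_packing]). The case [n = 1] bounds each of these masses from
above, hence, by the product formula, from below by a positive constant; so [n]
is bounded. Thus [L] lies in finitely many cosets [H f] with [f] in [L], and
the group generated by [L] is generated by these [f] and the generators of [H].
*)

Local Open Scope classical_set_scope.
Local Open Scope ring_scope.

(** * Orthogonal representations and property (T) *)

(** A complete real inner product space whose form need not be definite: spaces
of square-integrable functions fit without a quotient by the null functions. *)
Record semiHilbert (R : realType) := SemiHilbert {
  semiHilbert_sort :> lmodType R ;
  sip : semiHilbert_sort -> semiHilbert_sort -> R ;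
  sipC : forall u v, sip u v = sip v u ;
  sip_linear : forall a u v w, sip (a *: u + v) w = a * sip u w + sip v w ;
  sip_ge0 : forall u, 0 <= sip u u ;
  sip_complete : forall u : nat -> semiHilbert_sort,
    (forall e, 0 < e -> exists N, forall m n, (N <= m)%N -> (N <= n)%N ->
       sip (u m - u n) (u m - u n) < e) ->
    exists l, forall e, 0 < e -> exists N, forall n, (N <= n)%N ->
       sip (u n - l) (u n - l) < e
}.

Section Complexification.
Variables (R : realType) (X : semiHilbert R).
Implicit Types u v w : X.
Local Notation "'[ u , v ]" := (sip u v).

Lemma sipDl u v w : '[u + v, w] = '[u, w] + '[v, w].
Proof. by rewrite -[u]scale1r sip_linear mul1r scale1r. Qed.

Lemma sip0l w : '[0, w] = 0.
Proof. by have := sipDl 0 0 w; rewrite addr0 => h; lra. Qed.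

Lemma sipZl a u w : '[a *: u, w] = a * '[u, w].
Proof. by rewrite -[a *: u]addr0 sip_linear sip0l addr0. Qed.

Lemma sipNl u w : '[- u, w] = - '[u, w].
Proof. by rewrite -scaleN1r sipZl mulN1r. Qed.

Lemma sipDr u v w : '[w, u + v] = '[w, u] + '[w, v].
Proof. by rewrite ![sip w _]sipC sipDl. Qed.

Lemma sipZr a u w : '[w, a *: u] = a * '[w, u].
Proof. by rewrite ![sip w _]sipC sipZl. Qed.

Lemma sipNr u w : '[w, - u] = - '[w, u].
Proof. by rewrite ![sip w _]sipC sipNl. Qed.

Definition sipE := (sipDl, sipDr, sipNl, sipNr, sipZl, sipZr).

(** The Cauchy-Schwarz inequality in quadratic form: [a + 2 t b + t^2 c] is the
squared norm of [u + t w]. *)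
Lemma discriminant_le0 (a b c : R) :
  (forall t, 0 <= a + 2 * t * b + t ^+ 2 * c) -> b ^+ 2 <= a * c.
Proof.
move=> h; have a0 : 0 <= a by have := h 0; rewrite expr0n /= !(mulr0, mul0r, addr0).
have [c0|c0] := eqVneq c 0.
  have [->|b0] := eqVneq b 0; first by rewrite c0 expr0n mulr0.
  have := h (- (a + 1) / (2 * b)); rewrite c0.
  have -> : 2 * (- (a + 1) / (2 * b)) * b = - (a + 1) by field.
  by move=> ?; exfalso; lra.
have cgt : 0 < c.
  rewrite lt_def c0 leNgt; apply/negP => clt.
  have := h ((a + b ^+ 2) / - c + 1); have := h (- ((a + b ^+ 2) / - c + 1)).
  set t := _ + 1 => h1 h2.
  have t1 : 1 <= t by rewrite lerDr divr_ge0 ?addr_ge0 ?sqr_ge0// oppr_ge0 ltW.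
  have tc : t * c = - (a + b ^+ 2) + c by rewrite /t; field.
  have : 0 <= a + t * (t * c) by nra.
  by rewrite tc => ?; nra.
have := h (- b / c).
have -> : a + 2 * (- b / c) * b + (- b / c) ^+ 2 * c = (a * c - b ^+ 2) / c by field.
by rewrite pmulr_lge0 ?invr_gt0// subr_ge0.
Qed.

(** The Hilbert space attached to [X] is the complexification of the quotient of
[X] by its null vectors. The vector [u + i v] is represented by the functional
[w |-> <u, w> + i <v, w>]; two pairs give the same functional exactly when they
differ by null vectors, so function extensionality performs the quotient. *)
Definition sfunctional u v : X -> R[i]^o := fun w => ('[u, w] +i* '[v, w])%C.

Definition is_sfunctional (f : X -> R[i]^o) : bool :=
  `[< exists uv, f = sfunctional uv.1 uv.2 >].

Lemma sfunctional_submod : GRing.submod_closed (is_sfunctional : {pred _}).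
Proof.
split.
  apply/asboolP; exists (0, 0); apply/funext => w.
  by rewrite /sfunctional/= !sip0l.
move=> [a b] f g /asboolP[[u v] ->] /asboolP[[u' v'] ->]; apply/asboolP.
exists (a *: u - b *: v + u', b *: u + a *: v + v'); apply/funext => w.
rewrite /sfunctional /= !sipE.
transitivity ((a +i* b) * ('[u, w] +i* '[v, w]) + ('[u', w] +i* '[v', w]))%C.
  by [].
simpc; congr (_ +i* _)%C; ring.
Qed.
HB.instance Definition _ := GRing.isSubmodClosed.Build _ _
  is_sfunctional sfunctional_submod.

Record hilb := Hilb { hval :> X -> R[i]^o ; hvalP : is_sfunctional hval }.
HB.instance Definition _ := [isSub for hval].
HB.instance Definition _ := [Choice of hilb by <:].
HB.instance Definition _ := [SubChoice_isSubLmodule of hilb by <:].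

Lemma hilb_repr (f : hilb) : {uv : X * X | hval f = sfunctional uv.1 uv.2}.
Proof. by apply: cid; exact/asboolP/hvalP. Qed.
(** The real and imaginary parts are chosen representatives, meaningful only up
to null vectors; only their inner products are well defined. *)
Definition hre f := (sval (hilb_repr f)).1.
Definition him f := (sval (hilb_repr f)).2.
Lemma hilbE f : hval f = sfunctional (hre f) (him f).
Proof. exact: (svalP (hilb_repr f)). Qed.

Lemma sfunctional_inj u v u' v' : sfunctional u v = sfunctional u' v' ->
  (forall w, '[u, w] = '[u', w]) /\ (forall w, '[v, w] = '[v', w]).
Proof.
by move=> e; split=> w; have /= := congr1 (fun f : X -> R[i]^o => f w) e; case.
Qed.

Lemma hre_functional f u v : hval f = sfunctional u v ->
  forall w, '[hre f, w] = '[u, w].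
Proof. by rewrite hilbE => /sfunctional_inj[]. Qed.

Lemma him_functional f u v : hval f = sfunctional u v ->
  forall w, '[him f, w] = '[v, w].
Proof. by rewrite hilbE => /sfunctional_inj[]. Qed.

Lemma hval_linear (c : R[i]) (f g : hilb) :
  hval (c *: f + g) =
  sfunctional (complex.Re c *: hre f - complex.Im c *: him f + hre g)
              (complex.Im c *: hre f + complex.Re c *: him f + him g).
Proof.
transitivity (c *: hval f + hval g); first by [].
rewrite (hilbE f) (hilbE g); case: c => a b; apply/funext => w.
rewrite /sfunctional /= !sipE.
transitivity ((a +i* b) * ('[hre f, w] +i* '[him f, w]) + ('[hre g, w] +i* '[him g, w]))%C.
  by [].
simpc; congr (_ +i* _)%C; ring.
Qed.

Definition hinner (f g : hilb) : R[i] :=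
  (('[hre f, hre g] + '[him f, him g]) +i* ('[him f, hre g] - '[hre f, him g]))%C.

Lemma hinner_linear (c : R[i]) f g h :
  hinner (c *: f + g) h = c * hinner f h + hinner g h.
Proof.
have e := hval_linear c f g.
rewrite /hinner !(hre_functional e) !(him_functional e) !sipE.
by case: c {e} => a b; simpc; congr (_ +i* _)%C => /=; ring.
Qed.

Lemma hinnerC f g : hinner f g = Num.conj (hinner g f).
Proof.
transitivity (hinner g f)^*%C; last by [].
rewrite /hinner /= ![sip _ (hre g)]sipC ![sip _ (him g)]sipC.
by congr (_ +i* _)%C; ring.
Qed.

Definition hsqnorm f : R := '[hre f, hre f] + '[him f, him f].

Lemma hsqnorm_ge0 f : 0 <= hsqnorm f.
Proof. by rewrite addr_ge0// sip_ge0. Qed.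

Lemma hinner_sqnorm f : hinner f f = (hsqnorm f)%:C%C.
Proof. by rewrite /hinner sipC subrr. Qed.

Lemma hsqnormE f u v : hval f = sfunctional u v ->
  hsqnorm f = '[u, u] + '[v, v].
Proof.
move=> e; rewrite /hsqnorm (hre_functional e) (him_functional e).
by rewrite sipC (hre_functional e) [sip v _]sipC (him_functional e).
Qed.

Lemma sip0P u : '[u, u] = 0 -> forall w, '[u, w] = 0.
Proof.
move=> u0 w; have : '[u, w] ^+ 2 <= '[u, u] * '[w, w].
  apply: discriminant_le0 => t.
  have := sip_ge0 (u + t *: w); rewrite !sipE [sip w u]sipC.
  by congr (0 <= _); ring.
by rewrite u0 mul0r => h; apply/eqP; rewrite -sqrf_eq0 eq_le h sqr_ge0.
Qed.

Lemma hsqnorm_eq0 f : hsqnorm f = 0 -> f = 0.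
Proof.
move=> /eqP; rewrite paddr_eq0 ?sip_ge0// => /andP[/eqP f0 /eqP f1].
apply: val_inj; rewrite /= hilbE; apply/funext => w.
by rewrite /sfunctional sip0P// sip0P.
Qed.

Lemma hsqnormZ (c : R[i]) f :
  hsqnorm (c *: f) = (complex.Re c ^+ 2 + complex.Im c ^+ 2) * hsqnorm f.
Proof.
have e := hval_linear c f 0; rewrite addr0 in e; rewrite (hsqnormE e) /hsqnorm.
have e0 : hval (0 : hilb) = sfunctional 0 0.
  by apply/funext => w; rewrite /sfunctional !sip0l.
rewrite !sipE !(hre_functional e0) !(him_functional e0) !sip0l.
rewrite ![sip _ (hre 0)]sipC ![sip _ (him 0)]sipC !(hre_functional e0) !(him_functional e0) !sip0l.
by rewrite [sip (him f) (hre f)]sipC; ring.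
Qed.

Lemma hsqnormD f g : hsqnorm (f + g) =
  hsqnorm f + hsqnorm g + 2 * ('[hre f, hre g] + '[him f, him g]).
Proof.
have e := hval_linear 1 f g; rewrite scale1r in e.
rewrite (hsqnormE e) /hsqnorm /= !sipE.
by rewrite [sip (hre g) (hre f)]sipC [sip (him g) (him f)]sipC; ring.
Qed.

Definition hnorm f : R[i] := (Num.sqrt (hsqnorm f))%:C%C.

Lemma ler_hnormD f g : hnorm (f + g) <= hnorm f + hnorm g.
Proof.
rewrite /hnorm -rmorphD lecR -(@ler_pXn2r _ 2)// ?nnegrE ?addr_ge0 ?sqrtr_ge0//.
rewrite sqr_sqrtr ?hsqnorm_ge0// sqrrD !sqr_sqrtr ?hsqnorm_ge0//.
rewrite hsqnormD [leRHS]addrAC lerD2l -[leRHS]mulr_natl ler_pM2l//.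
rewrite -sqrtrM ?hsqnorm_ge0//.
apply: le_trans (ler_norm _) _; rewrite -sqrtr_sqr ler_sqrt ?mulr_ge0 ?hsqnorm_ge0//.
apply: discriminant_le0 => t.
have := hsqnorm_ge0 (f + t%:C%C *: g); rewrite hsqnormD hsqnormZ /=.
have e := hval_linear t%:C%C g 0; rewrite addr0 in e.
have e0 : hval (0 : hilb) = sfunctional 0 0.
  by apply/funext => w; rewrite /sfunctional !sip0l.
rewrite [sip (hre f) _]sipC [sip (him f) _]sipC (hre_functional e) (him_functional e) /=.
rewrite !sipE !(hre_functional e0) !(him_functional e0) !sip0l.
by rewrite [sip (him g) (him f)]sipC [sip (hre g) (hre f)]sipC; congr (0 <= _); ring.
Qed.

Lemma hnormZ (c : R[i]) f : hnorm (c *: f) = `|c| * hnorm f.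
Proof.
rewrite /hnorm hsqnormZ sqrtrM ?addr_ge0 ?sqr_ge0// rmorphM.
by congr (_ * _); rewrite normc_def.
Qed.

Lemma hnorm_eq0 f : hnorm f = 0 -> f = 0.
Proof.
move=> /(congr1 (@complex.Re R)) /= /eqP; rewrite sqrtr_eq0 => f0.
by apply: hsqnorm_eq0; apply/eqP; rewrite eq_le f0 hsqnorm_ge0.
Qed.

HB.instance Definition _ :=
  Lmodule_isNormed.Build R[i] hilb ler_hnormD hnormZ hnorm_eq0.

Lemma hilb_normE f : `|f| = (Num.sqrt (hsqnorm f))%:C%C.
Proof. by []. Qed.

Lemma hilb_ltr_norm f (e : R) : 0 < e -> (`|f| < e%:C%C) = (hsqnorm f < e ^+ 2).
Proof.
move=> e0; rewrite hilb_normE ltcR.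
by rewrite -(@ltr_pXn2r _ 2)// ?nnegrE ?sqrtr_ge0// ?ltW// sqr_sqrtr// hsqnorm_ge0.
Qed.

Lemma hvalB f g : hval (f - g) = sfunctional (hre f - hre g) (him f - him g).
Proof.
transitivity (hval f - hval g); first by [].
rewrite (hilbE f) (hilbE g); apply/funext => w.
by rewrite /sfunctional !sipE.
Qed.

Definition hofpair u v : hilb :=
  @Hilb (sfunctional u v) (asboolT (ex_intro (fun uv => sfunctional u v = sfunctional uv.1 uv.2) (u, v) erefl)).

(** A Cauchy filter is followed along a sequence with geometric rate, so that
the completeness of [X], stated for sequences, applies to both components. *)
Lemma hilb_cauchy_cvg (F : set_system hilb) :
  ProperFilter F -> cauchy F -> cvg F.
Proof.
move=> FF Fc.
pose d n : R := 2^-1 ^+ n.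
have d0 n : 0 < d n by rewrite exprn_gt0.
have /choice[x Fx] : forall n, exists x : hilb, F (ball x (d n)%:C%C).
  by move=> n; have [|x Fx] := ((cauchyP F).1 Fc) (d n)%:C%C; [rewrite ltcR|exists x].
have xx m n : `|x m - x n| < (d m + d n)%:C%C.
  have [y []] := filter_ex (filterI (Fx m) (Fx n)).
  rewrite -!ball_normE /= => xy xy'; rewrite rmorphD.
  rewrite -[x m](subrK y) -addrA; apply: le_lt_trans (ler_normD _ _) _.
  by apply: ltrD => //; rewrite distrC.
have xq m n : hsqnorm (x m - x n) < (d m + d n) ^+ 2.
  by rewrite -hilb_ltr_norm ?addr_gt0.
have dlt e : 0 < e -> exists N, forall n, (N <= n)%N -> d n < e.
  move=> e0; have [N _ h] : \forall n \near \oo, d n < e.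
    have /cvgrPdist_lt /(_ _ e0) : d @ \oo --> 0.
      by apply: cvg_expr; rewrite gtr0_norm// invf_lt1 // ltr1n.
    by apply: filterS => n; rewrite sub0r normrN gtr0_norm.
  by exists N.
have sC (s : hilb -> X) : (forall f g, '[s f - s g, s f - s g] <= hsqnorm (f - g)) ->
    exists l, forall e, 0 < e -> exists N, forall n, (N <= n)%N ->
       '[s (x n) - l, s (x n) - l] < e.
  move=> hs; apply: sip_complete => e e0.
  have se0 : 0 < Num.sqrt e / 2 by rewrite divr_gt0// sqrtr_gt0.
  have [N hN] := dlt _ se0; exists N => m n Nm Nn.
  apply: le_lt_trans (hs _ _) _; apply: lt_trans (xq _ _) _.
  rewrite -[ltRHS]sqr_sqrtr ?ltW// ltr_pXn2r ?nnegrE ?addr_ge0 ?sqrtr_ge0 ?ltW//.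
  by rewrite [ltRHS]splitr ltrD// hN.
have [l1 hl1] : exists l, forall e, 0 < e -> exists N, forall n, (N <= n)%N ->
       '[hre (x n) - l, hre (x n) - l] < e.
  by apply: sC => f g; rewrite (hsqnormE (hvalB f g)) lerDl sip_ge0.
have [l2 hl2] : exists l, forall e, 0 < e -> exists N, forall n, (N <= n)%N ->
       '[him (x n) - l, him (x n) - l] < e.
  by apply: sC => f g; rewrite (hsqnormE (hvalB f g)) lerDr sip_ge0.
apply/cvg_ex; exists (hofpair l1 l2).
apply/cvg_ballP => e e0.
have [eE er0] : e = (complex.Re e)%:C%C /\ 0 < complex.Re e.
  by case: e e0 => a b; rewrite ltcE /= => /andP[/eqP -> ->].
move: (complex.Re e) er0 eE => r r0 -> {e e0}.
have r20 : 0 < r / 2 by rewrite divr_gt0.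
have q0 : 0 < (r / 2) ^+ 2 / 2 by rewrite divr_gt0// exprn_gt0.
have [N0 h0] := dlt _ r20; have [N1 h1] := hl1 _ q0; have [N2 h2] := hl2 _ q0.
pose n := maxn N0 (maxn N1 N2).
apply: filterS (Fx n) => y; rewrite -!ball_normE /= => xy.
rewrite -[hofpair _ _](subrK (x n)) -addrA (splitr r) rmorphD.
apply: le_lt_trans (ler_normD _ _) _; apply: ltrD; last first.
  by apply: lt_trans xy _; rewrite ltcR h0// leq_maxl.
rewrite distrC hilb_ltr_norm//.
have e : hval (x n - hofpair l1 l2) = sfunctional (hre (x n) - l1) (him (x n) - l2).
  transitivity (hval (x n) - sfunctional l1 l2); first by [].
  by rewrite (hilbE (x n)); apply/funext => w; rewrite /sfunctional !sipE.
rewrite (hsqnormE e) [ltRHS]splitr ltrD//.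
  by apply: h1; rewrite leq_max leq_max leqnn orbT.
by apply: h2; rewrite leq_max leq_max leqnn !orbT.
Qed.
HB.instance Definition _ := Uniform_isComplete.Build hilb hilb_cauchy_cvg.

Lemma hinner_linearr f c g h :
  hinner f (c *: g + h) = Num.conj c * hinner f g + hinner f h.
Proof. by rewrite hinnerC hinner_linear rmorphD rmorphM [hinner f g]hinnerC [hinner f h]hinnerC. Qed.

Lemma hinnerDl h : zmod_morphism (hinner^~ h).
Proof. by move=> f g /=; rewrite addrC -scaleN1r hinner_linear mulN1r addrC. Qed.
Lemma hinnerDr f : zmod_morphism (hinner f).
Proof.
move=> g h /=; rewrite addrC -scaleN1r hinner_linearr rmorphN1 mulN1r addrC //.
Qed.
Lemma hinner0l f : hinner 0 f = 0.
Proof. by rewrite -(subrr (0 : hilb)) hinnerDl subrr. Qed.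
Lemma hinner0r f : hinner f 0 = 0.
Proof. by rewrite -(subrr (0 : hilb)) hinnerDr subrr. Qed.
Lemma hinnerZl h : scalable_for *%R (hinner^~ h).
Proof. by move=> c f /=; rewrite -[c *: f]addr0 hinner_linear hinner0l addr0. Qed.
Lemma hinnerZr f : scalable_for (Num.conj \; *%R) (hinner f).
Proof. by move=> c g /=; rewrite -[c *: g]addr0 hinner_linearr hinner0r addr0. Qed.
HB.instance Definition _ := @isBilinear.Build R[i] hilb hilb R[i] *%R (Num.conj \; *%R) hinner
  hinnerDl hinnerDr hinnerZl hinnerZr.
Lemma hinner_hermitian f g : hinner f g = (-1) ^+ false * Num.conj (hinner g f).
Proof. by rewrite expr0 mul1r hinnerC. Qed.
HB.instance Definition _ := @isHermitianSesquilinear.Build R[i] hilb false Num.conj hinner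
  hinner_hermitian.
Lemma hinner_gt0 f : f != 0 -> 0 < hinner f f.
Proof.
move=> f0; rewrite hinner_sqnorm ltcR lt_def hsqnorm_ge0 andbT.
by apply: contra f0 => /eqP/hsqnorm_eq0 ->.
Qed.
HB.instance Definition _ := @isDotProduct.Build R[i] hilb hinner hinner_gt0.

Lemma hinner_norm f : hinner f f = `|f| ^+ 2.
Proof. by rewrite hinner_sqnorm hilb_normE -rmorphXn sqr_sqrtr// hsqnorm_ge0. Qed.

Definition hilb_hilbertSpace : hilbertSpace R :=
  @HilbertSpace R hilb hinner hinner_norm.

End Complexification.

Section OrthogonalRepresentations.
Variables (R : realType) (G : topologicalGroupType).
Local Notation "'[ u , v ]" := (sip u v).

(** As the action is isometric, continuity of the orbits at the identity spreads
to the whole group. *)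
Record orthogonal_representation (X : semiHilbert R) (pi : G -> X -> X) : Prop := {
  orep_linear : forall g, linear (pi g) ;
  orep_sip : forall g u v, '[pi g u, pi g v] = '[u, v] ;
  orep1 : forall u, pi 1%g u = u ;
  orepM : forall g h u, pi (g * h)%g u = pi g (pi h u) ;
  orep_continuous : forall u (e : R), 0 < e ->
    \forall g \near (1%g : G), '[pi g u - u, pi g u - u] < e
}.

Lemma translation_cvg1 (g : G) : (g^-1 * h)%g @[h --> g] --> (1%g : G).
Proof.
rewrite -(mulVg g); apply: (@continuous_comp _ _ _ (fun x : G => (g^-1, x)%g)
  (fun z : G * G => z.1 * z.2)%g); last exact: mulg_continuous.
by apply: cvg_pair; [exact: cvg_cst | exact: cvg_id].
Qed.

Section Extension.
Variables (X : semiHilbert R) (pi : G -> X -> X).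
Hypothesis pi_rep : orthogonal_representation pi.

(** The adjoint of [pi g] is [pi g^-1]; hence a functional [u + i v] is moved by
precomposition with [pi g^-1]. *)
Lemma orep_adjoint g u v : '[u, pi g^-1%g v] = '[pi g u, v].
Proof. by rewrite -(orep_sip pi_rep g) -(orepM pi_rep) mulgV (orep1 pi_rep). Qed.

Lemma orepB g u v : pi g (u - v) = pi g u - pi g v.
Proof. by rewrite addrC -scaleN1r (orep_linear pi_rep) scaleN1r addrC. Qed.

Lemma hrep_subproof g (f : hilb X) : is_sfunctional (hval f \o pi g^-1%g).
Proof.
apply/asboolP; exists (pi g (hre f), pi g (him f)); apply/funext => w /=.
by rewrite hilbE /sfunctional !orep_adjoint.
Qed.
Definition hrep g (f : hilb X) : hilb X := Hilb (hrep_subproof g f).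

Lemma hrepE g f : hval (hrep g f) = sfunctional (pi g (hre f)) (pi g (him f)).
Proof. by apply/funext => w /=; rewrite hilbE /sfunctional !orep_adjoint. Qed.

Lemma hrepBE g h f : hsqnorm (hrep g f - hrep h f) =
  '[pi g (hre f) - pi h (hre f), pi g (hre f) - pi h (hre f)] +
  '[pi g (him f) - pi h (him f), pi g (him f) - pi h (him f)].
Proof.
apply: hsqnormE; transitivity (hval (hrep g f) - hval (hrep h f)); first by [].
by rewrite !hrepE; apply/funext => w; rewrite /sfunctional !sipE.
Qed.

Lemma hrep_unitary : @unitary_representation R G (hilb_hilbertSpace X) hrep.
Proof.
have hrep1 f : hrep 1%g f = f.
  by apply: val_inj; apply/funext => w /=; rewrite invg1 (orep1 pi_rep).
have hrepM g h f : hrep (g * h)%g f = hrep g (hrep h f).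
  by apply: val_inj; apply/funext => w /=; rewrite invgM (orepM pi_rep).
split=> //.
- move=> g; split.
  + by move=> c f f'; apply: val_inj; apply/funext.
  + move=> f _; exists (hrep g^-1%g f) => //.
    by rewrite -hrepM mulgV hrep1.
  + move=> f f' /=; rewrite /hinner.
    have hr a := hre_functional (hrepE g a); have hi a := him_functional (hrepE g a).
    have rr a b : '[hre (hrep g a), hre (hrep g b)] = '[hre a, hre b].
      by rewrite hr sipC hr (orep_sip pi_rep) sipC.
    have ii a b : '[him (hrep g a), him (hrep g b)] = '[him a, him b].
      by rewrite hi sipC hi (orep_sip pi_rep) sipC.
    have ri a b : '[hre (hrep g a), him (hrep g b)] = '[hre a, him b].
      by rewrite hr sipC hi (orep_sip pi_rep) sipC.
    have ir a b : '[him (hrep g a), hre (hrep g b)] = '[him a, hre b].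
      by rewrite hi sipC hr (orep_sip pi_rep) sipC.
    by rewrite rr ii ri ir.
- move=> f g; apply/cvgrPdist_lt => e e0.
  have [eE er0] : e = (complex.Re e)%:C%C /\ 0 < complex.Re e.
    by case: e e0 => a b; rewrite ltcE /= => /andP[/eqP -> ->].
  move: (complex.Re e) er0 eE => r r0 -> {e e0}.
  have q0 : 0 < r ^+ 2 / 2 by rewrite divr_gt0// exprn_gt0.
  have h u : \forall h \near g, '[pi g u - pi h u, pi g u - pi h u] < r ^+ 2 / 2.
    have H1 : \forall h \near g,
        '[pi (g^-1 * h)%g u - u, pi (g^-1 * h)%g u - u] < r ^+ 2 / 2.
      exact: (@translation_cvg1 g _ (orep_continuous pi_rep u q0)).
    apply: filterS H1 => h; congr (_ < _).
    rewrite -(orep_sip pi_rep g) orepB -(orepM pi_rep) mulgA mulgV mul1g.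
    by rewrite !sipE [sip (pi g u) (pi h u)]sipC; ring.
  near=> k; rewrite hilb_ltr_norm// hrepBE [ltRHS]splitr ltrD//.
    by near: k; exact: h.
  by near: k; exact: h.
Unshelve. all: by end_near. Qed.

End Extension.

(** Property (T) passes to real representations through the complexification:
an invariant vector of the latter has a real or an imaginary part of positive
norm. Invariance holds only up to null vectors, and the constant is squared
because squared norms are compared. *)
Lemma property_T_orthogonal : property_T R G ->
  exists (Q : set G) (eps : R), [/\ compact Q, 0 < eps &
    forall (X : semiHilbert R) (pi : G -> X -> X),
      orthogonal_representation pi ->
      forall u, 0 < '[u, u] ->
      (forall g, Q g -> '[pi g u - u, pi g u - u] < eps * '[u, u]) ->
      exists2 v, 0 < '[v, v] & forall g, '[pi g v - v, pi g v - v] = 0].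
Proof.
move=> [Q [eps [cQ eps0 T]]]; exists Q, (eps ^+ 2); split => //.
  by rewrite exprn_gt0.
move=> X pi pi_rep u u0 hu.
have [|f f0 finv] := T _ _ (hrep_unitary pi_rep).
  pose f := hofpair u 0; exists f.
    apply/eqP => /(congr1 (@hsqnorm R X)); rewrite (@hsqnormE _ _ _ u 0)// sip0l addr0.
    rewrite (@hsqnormE _ _ _ 0 0) ?sip0l ?addr0; last first.
      by apply/funext => w; rewrite /sfunctional !sip0l.
    by move=> e; rewrite e ltxx in u0.
  move=> g Qg; rewrite [X in _ < _ * X]hilb_normE -rmorphM hilb_ltr_norm; last first.
    by rewrite mulr_gt0// sqrtr_gt0 (@hsqnormE _ _ _ u 0)// sip0l addr0.
  have e : hval (hrep pi_rep g f - f) = sfunctional (pi g u - u) 0.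
    apply/funext => w.
    transitivity (sfunctional u 0 (pi g^-1%g w) - sfunctional u 0 w); first by [].
    rewrite /sfunctional !sip0l !sipE (orep_adjoint pi_rep).
    transitivity ((('[pi g u, w] +i* 0) - ('[u, w] +i* 0))%C : R[i]); first by [].
    by simpc.
  rewrite (hsqnormE e) sip0l addr0 exprMn sqr_sqrtr ?hsqnorm_ge0//.
  by rewrite (@hsqnormE _ _ _ u 0)// sip0l addr0; exact: hu.
have hinv g : '[pi g (hre f) - hre f, pi g (hre f) - hre f] +
    '[pi g (him f) - him f, pi g (him f) - him f] = 0.
  have := hrepBE pi_rep g 1%g f; rewrite !(orep1 pi_rep) => <-.
  rewrite !finv subrr (@hsqnormE _ _ _ 0 0) ?sip0l ?addr0//.
  by apply/funext => w; rewrite /sfunctional !sip0l.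
have := hsqnorm_ge0 f; rewrite le_eqVlt => /orP[/eqP/esym/hsqnorm_eq0 e|].
  by rewrite e eqxx in f0.
rewrite /hsqnorm => fpos.
have [r0|r0] := eqVneq '[hre f, hre f] 0.
  exists (him f); first by rewrite r0 add0r in fpos.
  by move=> g; have /eqP := hinv g; rewrite paddr_eq0 ?sip_ge0// => /andP[_ /eqP].
exists (hre f); first by rewrite lt_def r0 sip_ge0.
by move=> g; have /eqP := hinv g; rewrite paddr_eq0 ?sip_ge0// => /andP[/eqP].
Qed.

End OrthogonalRepresentations.

(** * Spaces of square-integrable functions *)
Lemma sum_half (R : realType) n : \sum_(0 <= k < n) (2^-1 : R) ^+ k <= 2.
Proof.
suff -> : \sum_(0 <= k < n) (2^-1 : R) ^+ k = 2 - 2 * 2^-1 ^+ n.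
  by rewrite gerBl mulr_ge0// exprn_ge0.
elim: n => [|n IH]; first by rewrite big_nil expr0 mulr1 subrr.
by rewrite big_nat_recr//= IH exprS; field.
Qed.

Lemma limn_einf_le (R : realType) (u : (\bar R)^nat) (e : \bar R) (N : nat) :
  (forall n, (N <= n)%N -> u n <= e)%E -> (limn_einf u <= e)%E.
Proof.
move=> h; rewrite limn_einf_lim; apply: lime_le; first exact: is_cvg_einfs.
apply: nearW => n; apply: (@le_trans _ _ (u (maxn n N))); last first.
  by apply: h; rewrite leq_maxr.
by apply: ereal_inf_lbound; exists (maxn n N) => //=; rewrite leq_maxl.
Qed.

Section SquareIntegrable.
Context d (T : measurableType d) (R : realType).
Variables (mu : {measure set T -> \bar R}) (D : set T) (mD : measurable D).
Implicit Types f g h : T -> R.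

Definition sqint f : \bar R := (\int[mu]_(x in D) (f x ^+ 2)%:E)%E.
Definition L2fun f := measurable_fun setT f /\ (sqint f < +oo)%E.

Lemma measurable_sq f : measurable_fun setT f ->
  measurable_fun D (fun x => (f x ^+ 2)%:E).
Proof.
move=> mf; apply/measurable_EFinP; apply: measurable_funTS.
exact: measurable_funX.
Qed.

(** From [(a + b)^2 <= 2 a^2 + 2 b^2]: a substitute for the triangle inequality
that needs no square roots. *)
Lemma sqint_lin (a : R) f g : measurable_fun setT f -> measurable_fun setT g ->
  (sqint (a *: f + g)%R <= (2 * a ^+ 2)%:E * sqint f + 2%:E * sqint g)%E.
Proof.
move=> mf mg; have eZ (c : R) h : 0 <= c -> measurable_fun setT h ->
    (c%:E * sqint h = \int[mu]_(x in D) (c%:E * (h x ^+ 2)%:E))%E.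
  move=> c0 mh; rewrite ge0_integralZl//; first exact: measurable_sq.
  by move=> x _; rewrite lee_fin sqr_ge0.
have a0 : 0 <= 2 * a ^+ 2 by rewrite mulr_ge0 ?sqr_ge0.
rewrite !eZ//.
rewrite -ge0_integralD//; last 4 first.
- by move=> x _; rewrite -EFinM lee_fin mulr_ge0 ?sqr_ge0.
- by apply: emeasurable_funM => //; exact: measurable_sq.
- by move=> x _; rewrite -EFinM lee_fin mulr_ge0 ?sqr_ge0.
- by apply: emeasurable_funM => //; exact: measurable_sq.
apply: ge0_le_integral => //.
- by move=> x _; rewrite lee_fin sqr_ge0.
- apply: measurable_sq; apply: measurable_funD => //.
  exact: (measurable_funM (measurable_cst a)).
- by apply: emeasurable_funD; apply: emeasurable_funM => //; exact: measurable_sq.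
- move=> x _; rewrite -!EFinM -EFinD lee_fin.
  change ((a * f x + g x) ^+ 2 <= 2 * a ^+ 2 * f x ^+ 2 + 2 * g x ^+ 2).
  rewrite -subr_ge0; have := sqr_ge0 (a * f x - g x).
  by congr (0 <= _); ring.
Qed.

Lemma L2fun_lin (a : R) f g : L2fun f -> L2fun g -> L2fun (a *: f + g).
Proof.
move=> [mf fi] [mg gi]; split.
  by apply: measurable_funD => //; exact: (measurable_funM (measurable_cst a)).
apply: le_lt_trans (sqint_lin a mf mg) _.
rewrite lte_add_pinfty//.
  by apply: lte_mul_pinfty => //; rewrite lee_fin mulr_ge0 ?sqr_ge0.
by apply: lte_mul_pinfty.
Qed.

Lemma L2fun0 : L2fun 0.
Proof.
split; first exact: measurable_cst.
by rewrite /sqint; under eq_integral do rewrite expr0n; rewrite integral0 ltry.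
Qed.

Lemma integrable_L2M f g : L2fun f -> L2fun g ->
  mu.-integrable D (EFin \o (fun x => f x * g x)).
Proof.
move=> [mf fi] [mg gi].
have mfg : measurable_fun D (EFin \o (fun x => f x * g x)).
  by apply/measurable_EFinP; apply: measurable_funTS; exact: measurable_funM.
apply/integrableP; split => //.
apply: (@le_lt_trans _ _ (sqint f + sqint g)%E); last exact: lte_add_pinfty.
rewrite /sqint -ge0_integralD//; last 4 first.
- by move=> x _; rewrite lee_fin sqr_ge0.
- exact: measurable_sq.
- by move=> x _; rewrite lee_fin sqr_ge0.
- exact: measurable_sq.
apply: ge0_le_integral => //.
- exact: measurableT_comp.
- by apply: emeasurable_funD; exact: measurable_sq.
- move=> x _; rewrite /= lee_fin normrM.
  have := sqr_ge0 (`|f x| - `|g x|); rewrite -[f x ^+ 2]real_normK ?num_real//.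
  by rewrite -[g x ^+ 2]real_normK ?num_real// => h; nra.
Qed.

Definition L2ip f g : R := \int[mu]_(x in D) (f x * g x).

Lemma L2ipC f g : L2ip f g = L2ip g f.
Proof. by apply: eq_Rintegral => x _; rewrite mulrC. Qed.

Lemma L2ip_lin (a : R) f g h : L2fun f -> L2fun g -> L2fun h ->
  L2ip (a *: f + g) h = a * L2ip f h + L2ip g h.
Proof.
move=> Lf Lg Lh; rewrite /L2ip -RintegralZl//; last exact: integrable_L2M.
rewrite -RintegralD//; last 2 first.
- have := integrable_L2M (L2fun_lin a Lf L2fun0) Lh.
  apply: eq_integrable => // x _ /=; rewrite mulrA; congr (_ * _)%:E.
  by rewrite addr0.
- exact: integrable_L2M.
apply: eq_Rintegral => x _; rewrite mulrA -mulrDl//.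
Qed.

Lemma L2ip_sqint f : L2fun f -> (L2ip f f)%:E = sqint f.
Proof.
move=> Lf; rewrite /L2ip /Rintegral fineK.
  by apply: eq_integral => x _; rewrite expr2.
exact: (integrable_fin_num mD (integrable_L2M Lf Lf)).
Qed.

Lemma L2ip_ge0 f : 0 <= L2ip f f.
Proof. by apply: Rintegral_ge0 => x _; rewrite -expr2 sqr_ge0. Qed.

(** Riesz-Fischer. A subsequence [v] with [sqint (v k.+1 - v k) <= 4^-k] converges
almost everywhere because [sum_k 2^k (v k.+1 - v k)^2] is integrable, and
Fatou's lemma gives the convergence of the whole sequence. The limit is defined
at every point by an upper limit, so it inherits every identity [u n t = u n t']
satisfied by all terms: this keeps exact invariance under the equivalence of
points, not only almost everywhere. *)
Lemma L2_complete (u : nat -> T -> R) : (forall n, measurable_fun setT (u n)) ->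
  (forall e : R, 0 < e -> exists N, forall m n, (N <= m)%N -> (N <= n)%N ->
     (sqint (u m - u n)%R < e%:E)%E) ->
  exists f, [/\ measurable_fun setT f,
    forall e : R, 0 < e -> exists N, forall n, (N <= n)%N ->
      (sqint (u n - f)%R <= e%:E)%E &
    forall t t', (forall n, u n t = u n t') -> f t = f t'].
Proof.
move=> mu_ uC.
have mB m n : measurable_fun setT (u m - u n) by exact: measurable_funB.
have /choice[N hN] : forall k, exists N, forall m n, (N <= m)%N -> (N <= n)%N ->
    (sqint (u m - u n)%R < (4^-1 ^+ k)%:E)%E by move=> k; apply: uC; rewrite exprn_gt0.
pose s k := (\sum_(i < k.+1) N i + k)%N.
have sN k l : (k <= l)%N -> (N k <= s l)%N.
  move=> kl; rewrite /s (bigD1 (Ordinal (kl : (k < l.+1)%N)))//= -!addnA.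
  exact: leq_addr.
pose v k := u (s k).
pose dd k t := v k.+1 t - v k t.
have mdd k : measurable_fun setT (dd k) by apply: (mB (s k.+1) (s k)).
have ddN k : (sqint (dd k) <= (4^-1 ^+ k)%:E)%E.
  exact: ltW (hN k (s k.+1) (s k) (sN k k.+1 (leqnSn k)) (sN k k (leqnn k))).
pose g t : \bar R := (\sum_(k <oo) (2 ^+ k * dd k t ^+ 2)%:E)%E.
have mg_ k : measurable_fun D (fun t => (2 ^+ k * dd k t ^+ 2)%:E).
  apply/measurable_EFinP; apply: measurable_funTS; apply: measurable_funM => //.
  exact: measurable_funX.
have g0 k t : D t -> (0 <= (2 ^+ k * dd k t ^+ 2)%:E)%E.
  by move=> _; rewrite lee_fin; apply: mulr_ge0; [exact: exprn_ge0|exact: sqr_ge0].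
have gfin : (\int[mu]_(t in D) g t < +oo)%E.
  rewrite integral_nneseries//.
  apply: (@le_lt_trans _ _ (\sum_(k <oo) (2^-1 ^+ k)%:E)%E).
    apply: lee_nneseries => [k _ _|k _]; first by apply: integral_ge0 => t; exact: g0.
    under eq_integral do rewrite EFinM.
    rewrite ge0_integralZl//; last 2 first.
    - exact: measurable_sq.
    - by move=> t _; rewrite lee_fin sqr_ge0.
    apply: (@le_trans _ _ ((2 ^+ k)%:E * (4^-1 ^+ k)%:E)%E).
      by rewrite lee_wpmul2l// ?lee_fin ?exprn_ge0//; exact: ddN.
    rewrite -EFinM lee_fin -exprMn.
    by rewrite (_ : 2 * 4^-1 = 2^-1 :> R)//; field.
  apply: (@le_lt_trans _ _ 2%:E); last exact: ltry.
  apply: lime_le; first by apply: is_cvg_nneseries => k _ _; rewrite lee_fin exprn_ge0.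
  by apply: nearW => n; rewrite sumEFin lee_fin sum_half.
have mg : measurable_fun D g.
  apply: (eq_measurable_fun (fun t =>
      \sum_(k <oo | k \in xpredT) (2 ^+ k * dd k t ^+ 2)%:E)%E).
    by move=> t _; apply: eq_eseriesl.
  by apply: ge0_emeasurable_sum => // k t Dt _; exact: g0.
have gint : mu.-integrable D g.
  apply/integrableP; split => //.
  rewrite (eq_integral g)// => t /[!inE] Dt; rewrite gee0_abs//.
  by apply: nneseries_ge0 => k _ _; exact: g0.
have vcvg : {ae mu, forall t, D t -> cvgn (v ^~ t)}.
  have := integrable_ae mD gint; apply: filterS => t /= gt Dt; have {}gt := gt Dt.
  pose C := fine (g t).
  have CE n : \sum_(0 <= k < n) (2 ^+ k * dd k t ^+ 2) <= C.
    rewrite -lee_fin /C fineK// -sumEFin.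
    by apply: nneseries_lim_ge => k _ _; exact: g0.
  have cdd : cvgn (series (dd ^~ t)).
    apply: normed_cvg.
    suff : cvgn (series (fun k => `|dd k t|)) by [].
    apply: nondecreasing_is_cvgn.
      by apply/nondecreasing_seqP => n; rewrite !seriesEnat/= big_nat_recr//= lerDl.
    exists ((C + 2) / 2) => _ [n _ <-]; rewrite seriesEnat/=.
    have -> : (C + 2) / 2 = C / 2 + 2 / 2 by field.
    apply: (@le_trans _ _ ((\sum_(0 <= k < n) (2 ^+ k * dd k t ^+ 2)) / 2
        + (\sum_(0 <= k < n) 2^-1 ^+ k) / 2)); last first.
      by rewrite lerD// ler_pM2r// ?sum_half ?CE.
    rewrite -mulrDl -big_split/= mulr_suml ler_sum// => k _.
    (* [|d| <= (2^k d^2 + 2^-k) / 2] bounds the increments by summable terms. *)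
    set a := 2 ^+ k; have a0 : 0 < a by rewrite exprn_gt0.
    have -> : (2^-1 : R) ^+ k = a^-1 by rewrite exprVn.
    rewrite ler_pdivlMr//.
    have := sqr_ge0 (a * `|dd k t| - 1).
    rewrite -[dd k t ^+ 2]real_normK ?num_real// => h.
    have -> : a * `|dd k t| ^+ 2 + a^-1 = (a ^+ 2 * `|dd k t| ^+ 2 + 1) / a.
      by field; rewrite gt_eqF.
    by rewrite ler_pdivlMr//; nra.
  have -> : v ^~ t = (fun n => v 0 t + series (dd ^~ t) n).
    apply/funext => n; rewrite (_ : dd ^~ t = telescope (v ^~ t))//.
    by rewrite telescopeK/= addrC subrK.
  by apply: is_cvgD => //; exact: is_cvg_cst.
pose f t := fine (limn_esup (fun k => (v k t)%:E)).
have mf : measurable_fun setT f.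
  apply: measurableT_comp; first exact: fine_measurable.
  apply: measurable_fun_limn_esup => n; apply/measurable_EFinP; exact: mu_.
exists f; split => //; last first.
  by move=> t t' h; rewrite /f; congr (fine (limn_esup _)); apply/funext => k; rewrite /v h.
move=> e e0; have [M hM] := uC e e0; exists M => n Mn.
have fae : ae_eq mu D (fun t => ((u n - f) t ^+ 2)%:E)
    (fun t => limn_einf (fun k => ((u n - v k) t ^+ 2)%:E)).
  apply: filterS vcvg => t h Dt; have {h}/cvg_ex[/= l vl] := h Dt.
  have fl : f t = l.
    have vlE : (fun k => (v k t)%:E) @ \oo --> l%:E.
      by apply: cvg_EFin => //; exact: nearW.
    by rewrite /f (cvg_limn_einf_sup vlE).2.
  have /cvg_limn_einf_sup[-> _] : (fun k => ((u n - v k) t ^+ 2)%:E) @ \oo --> ((u n t - l) ^+ 2)%:E.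
    apply: cvg_EFin; first exact: nearW.
    rewrite (_ : fine \o _ = fun k => (u n t - v k t) * (u n t - v k t)); last first.
      by apply/funext => k; rewrite /= expr2.
    have c : (fun k => u n t - v k t) @ \oo --> u n t - l.
      by apply: cvgB; [exact: cvg_cst|exact: vl].
    by rewrite expr2; exact: (cvgM c c).
  by rewrite -fl.
have msq k : measurable_fun D (fun t => ((u n - v k) t ^+ 2)%:E) by exact: (measurable_sq (mB n (s k))).
rewrite /sqint; under [leLHS]eq_integral do rewrite -[X in X%:E]/((u n - f) _ ^+ 2).
rewrite (ae_eq_integral _ _ mD _ _ fae); last 2 first.
- by apply: measurable_sq; exact: measurable_funB.
- apply: measurableT_comp => //; apply: measurable_fun_limn_esup => k.
  exact: measurableT_comp.
apply: le_trans (fatou _ _ _ _) _ => //.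
  by move=> k t _; rewrite lee_fin sqr_ge0.
apply: (@limn_einf_le _ _ _ M) => k Mk; apply: ltW; apply: hM => //.
by apply: (leq_trans Mk); rewrite /s leq_addl.
Qed.

(** The closure condition only concerns limits that satisfy every identity shared
by all the terms of the sequence, as those of [L2_complete] do. *)
Record L2subspace := mkL2subspace {
  L2sub_fun :> (T -> R) -> Prop ;
  L2sub_L2 : forall f, L2sub_fun f -> L2fun f ;
  L2sub0 : L2sub_fun 0 ;
  L2sub_lin : forall (a : R) f g, L2sub_fun f -> L2sub_fun g -> L2sub_fun (a *: f + g) ;
  L2sub_lim : forall (u : nat -> T -> R) f, (forall n, L2sub_fun (u n)) -> L2fun f ->
    (forall e : R, 0 < e -> exists N, forall n, (N <= n)%N ->
      (sqint (u n - f)%R <= e%:E)%E) ->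
    (forall t t', (forall n, u n t = u n t') -> f t = f t') -> L2sub_fun f
}.

Section Subspace.
Variable S : L2subspace.

Definition L2sub_pred (f : T -> R) : bool := `[< S f >].

Lemma L2sub_submod : GRing.submod_closed (L2sub_pred : {pred _}).
Proof.
split; first by apply/asboolP; exact: L2sub0.
by move=> a f g /asboolP Sf /asboolP Sg; apply/asboolP; exact: L2sub_lin.
Qed.
HB.instance Definition _ := GRing.isSubmodClosed.Build _ _
  L2sub_pred L2sub_submod.

Record L2sub := MkL2sub { L2sub_val :> T -> R ; L2sub_valP : L2sub_pred L2sub_val }.
HB.instance Definition _ := [isSub for L2sub_val].
HB.instance Definition _ := [Choice of L2sub by <:].
HB.instance Definition _ := [SubChoice_isSubLmodule of L2sub by <:].

Lemma L2subP (f : L2sub) : S (L2sub_val f).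
Proof. by have /asboolP := L2sub_valP f. Qed.

Lemma L2sub_L2fun (f : L2sub) : L2fun (L2sub_val f).
Proof. exact: L2sub_L2 (L2subP f). Qed.

Definition L2sub_ip (f g : L2sub) : R := L2ip f g.

Lemma L2sub_ip_sqint (f : L2sub) : (L2sub_ip f f)%:E = sqint f.
Proof. exact: L2ip_sqint (L2sub_L2fun f). Qed.

Lemma L2sub_ip_linear a (f g h : L2sub) :
  L2sub_ip (a *: f + g) h = a * L2sub_ip f h + L2sub_ip g h.
Proof. exact: L2ip_lin (L2sub_L2fun f) (L2sub_L2fun g) (L2sub_L2fun h). Qed.

Lemma L2sub_complete (u : nat -> L2sub) :
  (forall e, 0 < e -> exists N, forall m n, (N <= m)%N -> (N <= n)%N ->
     L2sub_ip (u m - u n) (u m - u n) < e) ->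
  exists l, forall e, 0 < e -> exists N, forall n, (N <= n)%N ->
     L2sub_ip (u n - l) (u n - l) < e.
Proof.
move=> uC; pose w n : T -> R := L2sub_val (u n).
have [|e e0|f [mf uf fP]] := @L2_complete w.
- by move=> n; have [] := L2sub_L2fun (u n).
- have [N hN] := uC e e0; exists N => m n Nm Nn.
  by have := hN m n Nm Nn; rewrite -lte_fin L2sub_ip_sqint.
have Lf : L2fun f.
  have [N hN] := uf 1 ltr01.
  have [mw wi] := L2sub_L2fun (u N).
  have mwf : measurable_fun setT (w N - f) by exact: measurable_funB.
  have Lwf : L2fun (w N - f).
    by split => //; apply: le_lt_trans (hN N (leqnn N)) _; exact: ltry.
  have := L2fun_lin (-1) Lwf (L2sub_L2fun (u N)).
  by rewrite scaleN1r opprB -[X in _ + X]/(w N) subrK.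
have Sf : L2sub_pred f.
  by apply/asboolP; apply: (L2sub_lim (u := w)) => // n; exact: L2subP.
exists (MkL2sub Sf) => e e0.
have [N hN] := uf (e / 2) (divr_gt0 e0 (ltr0Sn _ 1)).
exists N => n Nn; rewrite -lte_fin L2sub_ip_sqint.
by apply: le_lt_trans (hN n Nn) _; rewrite lte_fin ltr_pdivrMr// ltr_pMr// ltr1n.
Qed.

Definition L2sub_semiHilbert : semiHilbert R :=
  @SemiHilbert R L2sub L2sub_ip (fun v w => L2ipC (L2sub_val v) (L2sub_val w))
    L2sub_ip_linear (fun v => L2ip_ge0 (L2sub_val v)) L2sub_complete.

End Subspace.

End SquareIntegrable.

(** * Locally finite sets and approximate subgroups *)

(** Compactness as an induction principle: a property of sets that holds locally
and passes to finite unions holds for a set containing [K]. *)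
Lemma compact_cover_ind (T : topologicalType) (P : set T -> Prop) (K : set T) :
  compact K -> P set0 -> (forall A B, P A -> P B -> P (A `|` B)) ->
  (forall x, K x -> exists2 U, nbhs x U & P U) ->
  exists2 A, P A & K `<=` A.
Proof.
move=> /compact_near_coveringP cK P0 PU loc.
pose F := filter_from P (fun A => [set B : set T | A `<=` B]).
have FF : Filter F.
  apply: filter_from_filter; first by exists set0.
  move=> A B PA PB; exists (A `|` B); first exact: PU.
  by move=> C /= ABC; split=> x ?; apply: ABC; [left|right].
have [x /loc[U Ux PU']|A PA /(_ A) /= h] := cK _ F (fun B x => B x) FF.
  exists (U, [set B | U `<=` B]) => /=; last by move=> [y B] /= [Uy]; exact.
  by split => //; exists U.
by exists A => //; exact: h.
Qed.

Definition locally_finite (T : topologicalType) (X : set T) : Prop :=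
  forall K, compact K -> finite_set (X `&` K).

Section LocallyFinite.
Variable T : topologicalType.
Implicit Types X Y : set T.

Lemma locally_finiteS X Y : X `<=` Y -> locally_finite Y -> locally_finite X.
Proof. by move=> XY Yf K /Yf; apply: sub_finite_set; exact: setSI. Qed.

Hypotheses (hT : hausdorff_space T) (lT : locally_compact [set: T]).

Lemma compact_nbhs (x : T) : exists2 K, nbhs x K & compact K /\ closed K.
Proof.
have [K + KcK] := (lT : forall x, _) x I.
rewrite /within /= => xK; exists K => //.
by apply: filterS xK => y; exact.
Qed.

Lemma locally_finite_closed X : locally_finite X -> closed X.
Proof.
move=> Xf x clx; have [K xK [cK _]] := compact_nbhs x.
have : closed (X `&` K).
  by apply: compact_closed => //; apply: finite_compact; exact: Xf.
suff : closure (X `&` K) x by move=> h /(_ _ h) [].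
by move=> V xV; have [y [Xy [Vy Ky]]] := clx _ (filterI xV xK); exists y.
Qed.

End LocallyFinite.

Section GroupTopology.
Variable G : topologicalGroupType.
Implicit Types (g : G) (X Y K : set G).

Lemma mulgl_continuous g : continuous (fun x : G => g * x)%g.
Proof.
move=> x; apply: (@continuous_comp _ _ _ (fun x : G => (g, x)%g)
  (fun z : G * G => z.1 * z.2)%g); last exact: mulg_continuous.
by apply: cvg_pair; [exact: cvg_cst | exact: cvg_id].
Qed.

Lemma mulgr_continuous g : continuous (fun x : G => x * g)%g.
Proof.
move=> x; apply: (@continuous_comp _ _ _ (fun x : G => (x, g)%g)
  (fun z : G * G => z.1 * z.2)%g); last exact: mulg_continuous.
by apply: cvg_pair; [exact: cvg_id | exact: cvg_cst].
Qed.

Lemma invmulg_continuous : continuous (fun z : G * G => z.1^-1 * z.2)%g.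
Proof.
move=> [x y]; apply: (@continuous_comp _ _ _ (fun z : G * G => (z.1^-1, z.2)%g)
  (fun z : G * G => z.1 * z.2)%g); last exact: mulg_continuous.
apply: cvg_pair => /=; last exact: cvg_snd.
apply: (@cvg_comp _ _ _ fst (fun x : G => x^-1)%g _ (nbhs x)).
  exact: cvg_fst.
exact: invg_continuous.
Qed.

Lemma nbhs_invmul (U : set G) g : nbhs 1%g U ->
  exists2 V, nbhs g V & forall x y, V x -> V y -> U (x^-1 * y)%g.
Proof.
rewrite -(mulVg g) => /(@invmulg_continuous (g, g)) [[A B] /= [Ag Bg] AB].
exists (A `&` B); first exact: filterI.
by move=> x y [Ax _] [_ By]; exact: (AB (x, y)).
Qed.

Lemma compact_mulgset K K' : compact K -> compact K' -> compact (mulgset K K').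
Proof.
move=> cK cK'.
have -> : mulgset K K' = (fun z : G * G => z.1 * z.2)%g @` (K `*` K').
  apply/seteqP; split => [_ [x Kx [y Ky <-]]|_ [[x y] [/= Kx Ky] <-]].
    by exists (x, y).
  by exists x => //; exists y.
apply: continuous_compact; last exact: compact_setX.
by apply: continuous_subspaceT => x; exact: mulg_continuous.
Qed.

Lemma compact_invgset K : compact K -> compact (invgset K).
Proof.
move=> cK; apply: continuous_compact => //.
by apply: continuous_subspaceT => x; exact: invg_continuous.
Qed.

Lemma compact_invmul K : compact K -> compact (invmul K).
Proof. by move=> cK; apply: compact_mulgset => //; exact: compact_invgset. Qed.

Lemma compact_translate g K : compact K -> compact (translate g K).
Proof.
move=> cK; apply: continuous_compact => //.
by apply: continuous_subspaceT => x; exact: mulgl_continuous.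
Qed.

Lemma invmulP X z : invmul X z <-> exists x y, [/\ X x, X y & z = (x^-1 * y)%g].
Proof.
split=> [[_ [x Xx <-] [y Xy <-]]|[x [y [Xx Xy ->]]]]; first by exists x, y.
by exists (x^-1)%g; [exists x|exists y].
Qed.

(** A translate of a small neighborhood of the identity contains at most one
point of [X], and finitely many of them cover a compact set. *)
Lemma uniformly_discrete_locally_finite X :
  uniformly_discrete X -> locally_finite X.
Proof.
move=> [_ [U U1 UX]] K cK.
have [|||A Af KA] := @compact_cover_ind _ (fun A => finite_set (X `&` A)) _ cK.
- by rewrite setI0.
- by move=> A B ? ?; rewrite setIUr finite_setU.
- move=> x _; have [V Vx VU] := nbhs_invmul x U1; exists V => //.
  have [->//|/set0P[y [Xy Vy]]] := eqVneq (X `&` V) set0.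
  apply: (@sub_finite_set _ _ [set y]) => // z [Xz Vz] /=.
  have : (U `&` invmul X) (y^-1 * z)%g.
    by split; [exact: VU|apply/invmulP; exists y, z].
  by rewrite UX /= => /(congr1 (fun t => y * t)%g); rewrite mulVKg mulg1.
- by apply: sub_finite_set Af; exact: setIS.
Qed.

Lemma locally_finite_mulgset (F X : set G) :
  finite_set F -> locally_finite X -> locally_finite (mulgset F X).
Proof.
move=> Ff Xf K cK.
apply: (@sub_finite_set _ _ (\bigcup_(f in F)
    ((fun x => f * x)%g @` (X `&` translate f^-1%g K)))).
  move=> _ [[f Ff' [x Xx <-]] Kx]; exists f => //; exists x => //; split=> //.
  by exists (f * x)%g => //; rewrite mulKg.
apply: bigcup_finite => // f _; apply: finite_image.
by apply: Xf; exact: compact_translate.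
Qed.

End GroupTopology.

Section ApproximateSubgroups.
Variables (G : topologicalGroupType) (L : set G).
Hypotheses (hG : hausdorff_space G) (lG : locally_compact [set: G]).
Hypotheses (dL : uniformly_discrete L) (aL : approximate_subgroup L).

Lemma approx1 : L 1%g. Proof. by case: aL. Qed.

Lemma approxV x : L x -> L x^-1%g.
Proof. by move=> Lx; have [_ -> _] := aL; exists x. Qed.

Lemma invmul_approx : invmul L = mulgset L L.
Proof. by rewrite /invmul; case: aL => _ <-. Qed.

Lemma locally_finite_approx2 : locally_finite (mulgset L L).
Proof.
have [_ _ [F Ff LF]] := aL; apply: (locally_finiteS LF).
by apply: locally_finite_mulgset => //; exact: uniformly_discrete_locally_finite.
Qed.

(** The approximate subgroup property bounds a product of four factors by
[F F F L] with [F] finite. *)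
Lemma locally_finite_approx4 : locally_finite (mulgset (mulgset L L) (mulgset L L)).
Proof.
have [_ _ [F Ff LF]] := aL.
apply: (@locally_finiteS _ _ (mulgset F (mulgset F (mulgset F L)))); last first.
  by do 3!apply: locally_finite_mulgset => //; exact: uniformly_discrete_locally_finite.
have LF' x y : L x -> L y -> exists f z, [/\ F f, L z & (x * y = f * z)%g].
  move=> Lx Ly; have [|f Ff' [z Lz <-]] := LF (x * y)%g; last by exists f, z.
  by exists x => //; exists y.
move=> _ [_ [a La [b Lb <-]] [_ [c Lc [d Ld <-]] <-]].
have [f [z [Ff1 Lz ->]]] := LF' _ _ La Lb.
have [f' [z' [Ff2 Lz' e]]] := LF' _ _ Lz Lc.
have [f'' [z'' [Ff3 Lz'' e']]] := LF' _ _ Lz' Ld.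
exists f => //; exists (f' * (f'' * z''))%g.
  by exists f' => //; exists (f'' * z'')%g => //; exists f'' => //; exists z''.
by rewrite -e' [(f' * _)%g]mulgA -e !mulgA.
Qed.

(** The set [L^-1 L = L L] is locally finite, hence equal to its closure. *)
Lemma ext_hull_approx (P : ext_hull L) : invmul (P : set G) `<=` mulgset L L.
Proof.
have := @hull_setP _ _ P; rewrite /in_ext_hull invmul_approx.
rewrite -(closure_id _).1//; apply: locally_finite_closed => //.
exact: locally_finite_approx2.
Qed.

End ApproximateSubgroups.

Section SmallCovers.
Variable T : topologicalType.

Lemma second_countable_cover (S : set T -> Prop) :
  @second_countable T -> S set0 -> (forall A B, A `<=` B -> S B -> S A) ->
  (forall x : T, exists2 V, nbhs x V & S V) ->
  exists U : nat -> set T, [/\ forall j, open (U j), forall j, S (U j)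
    & forall x, exists j, U j x].
Proof.
move=> [B /countable_injP[f finj] [Bopen Bbase]] S0 SS loc.
pose C j := [set b | [/\ B b, S b & f b = j]].
exists (fun j => xget set0 (C j)); split => [j|j|x].
- by case: xgetP => [b _ [/Bopen]|_]//; exact: open0.
- by case: xgetP => [b _ []|].
- have [V /(Bbase x)[b [Bb bx] bV] SV] := loc x.
  have Cb : C (f b) b by split => //; exact: SS bV SV.
  exists (f b); case: xgetP => [b' _ [Bb' _ e]|/(_ b)]//.
  by rewrite (finj b' b) ?inE.
Qed.

End SmallCovers.

Section CoverOfHull.
Variables (G : topologicalGroupType) (L : set G).
Hypothesis lcscG : lcsc_group G.

(** The sets [U j] are so small that each of them contains at most one point of
any member of the hull. *)
Lemma small_open_cover : uniformly_discrete L ->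
  exists U : nat -> set G, [/\ forall j, open (U j),
    forall j x y, U j x -> U j y -> invmul L (x^-1 * y)%g -> x = y
    & forall x, exists j, U j x].
Proof.
move=> [_ [V V1 VL]]; have [_ _ sG] := lcscG.
apply: (second_countable_cover (S := fun A : set G => forall x y, A x -> A y ->
  invmul L (x^-1 * y)%g -> x = y)) => //.
- by move=> A B AB SB x y /AB Bx /AB By; exact: SB.
- move=> x; have [W Wx WV] := nbhs_invmul x V1; exists W => // y z Wy Wz yz.
  have : (V `&` invmul L) (y^-1 * z)%g by split=> //; exact: WV.
  by rewrite VL /= => /(congr1 (fun t => y * t)%g); rewrite mulVKg mulg1.
Qed.

Lemma compact_exhaustion : exists K : nat -> set G,
  [/\ forall n, compact (K n), nondecreasing_seq K & \bigcup_n K n = setT].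
Proof.
have [hG lG sG] := lcscG.
have [|||U [Uo Uc Ucov]] := @second_countable_cover G (@precompact G) sG _ _ _.
- by rewrite precompact_closed; [exact: compact0|exact: closed0].
- by move=> A B; exact: precompact_subset.
- move=> x; have [K Kx [cK clK]] := compact_nbhs lG x; exists K => //.
  by rewrite precompact_closed.
exists (fun n => \big[setU/set0]_(j < n) closure (U j)); split.
- by move=> n; apply: bigsetU_compact => j _; rewrite -precompactE.
- by move=> m n mn; apply/subsetPset; exact: (@subset_bigsetU _ (fun j => closure (U j)) m n mn).
- apply/seteqP; split=> // x _; have [j Ujx] := Ucov x.
  exists j.+1 => //; rewrite big_ord_recr /=; right.
  exact: subset_closure.
Qed.

End CoverOfHull.

(** * Left-invariant measures *)

(** Measurable types are pointed; the alias carries the identity as base point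
without touching the structures of [G]. *)
Definition group_carrier (G : topologicalGroupType) : Type := G.
HB.instance Definition _ (G : topologicalGroupType) := Choice.on (group_carrier G).
HB.instance Definition _ (G : topologicalGroupType) :=
  isPointed.Build (group_carrier G) (1%g : G).

Definition borelG (G : topologicalGroupType) :=
  g_sigma_algebraType (@open G : set (set (group_carrier G))).

Section BorelGroup.
Local Open Scope ereal_scope.
Variable G : topologicalGroupType.
Local Notation bG := (borelG G).

Lemma open_borelG (A : set G) : open A -> measurable (A : set bG).
Proof. by move=> oA; exact: sub_sigma_algebra. Qed.

Lemma closed_borelG (A : set G) : closed A -> measurable (A : set bG).
Proof.
by move=> cA; rewrite -[A]setCK; apply: measurableC; apply: open_borelG; exact: closed_openC.
Qed.

Lemma compact_borelG (A : set G) : hausdorff_space G -> compact A -> measurable (A : set bG).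
Proof. by move=> hG cA; apply: closed_borelG; exact: compact_closed. Qed.

Lemma continuous_borelG (f : G -> G) :
  continuous f -> measurable_fun [set: bG] (f : bG -> bG).
Proof.
move=> cf; apply: (@measurability _ _ _ bG _ _ (@open G : set (set bG))) => //.
move=> _ [A oA <-]; rewrite setTI; apply: open_borelG.
by apply: open_comp => // x _; exact: cf.
Qed.

Hypothesis sG : @second_countable G.

(** By second countability the preimage of an open set is a countable union of
products of basic open sets, hence belongs to the product sigma-algebra. *)
Lemma mulg_measurable_fun :
  measurable_fun [set: bG * bG] (fun z : bG * bG => ((z.1 : G) * (z.2 : G))%g : bG).
Proof.
have [B /countable_injP[f finj] [Bo Bb]] := sG.
apply: (@measurability _ _ _ bG _ _ (@open G : set (set bG))) => //.
move=> _ [A oA <-]; rewrite setTI.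
pose C n := [set b | B b /\ f b = n].
pose b n := xget set0 (C n).
have ob n : open (b n) by rewrite /b; case: xgetP => [_ _ [/Bo]|_] //; exact: open0.
pose S p := if `[< forall x y, b p.1 x -> b p.2 y -> A (x * y)%g >]
            then b p.1 `*` b p.2 else set0.
have -> : (fun z : bG * bG => ((z.1 : G) * (z.2 : G))%g : bG) @^-1` A =
    \bigcup_i \bigcup_j (S (i, j) : set (bG * bG)).
  apply/seteqP; split=> [[x y] /= Axy|[x y] [i _ [j _]]]; last first.
    by rewrite /S; case: asboolP => //= h [/= bx bY]; exact: h.
  have : nbhs (x * y)%g A by exact: open_nbhs_nbhs.
  move=> /(@mulg_continuous G (x, y)) [[V W] /= [xV yW] VW].
  have [b1 [Bb1 b1x] b1V] := Bb x _ xV; have [b2 [Bb2 b2y] b2W] := Bb y _ yW.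
  have bE c : B c -> b (f c) = c.
    move=> Bc; rewrite /b; case: xgetP => [c' _ [Bc' e]|/(_ c)[]//].
    by apply: finj => //; rewrite inE.
  exists (f b1) => //; exists (f b2) => //; rewrite /S /= !bE//.
  case: asboolP => // -[] u v b1u b2v; apply: (VW (u, v)).
  by split; [exact: b1V|exact: b2W].
apply: bigcupT_measurable => i; apply: bigcupT_measurable => j.
by rewrite /S; case: asboolP => // _; apply: measurableX; exact: open_borelG.
Qed.

End BorelGroup.

Section Haar.
Local Open Scope ereal_scope.
Variables (R : realType) (G : topologicalGroupType).
Hypothesis sG : @second_countable G.
Local Notation bG := (borelG G).
Variable m : {sigma_finite_measure set bG -> \bar R}.
Hypothesis m_inv : forall (g : G) (A : set bG), measurable A ->
  m ((fun x : bG => (g * (x : G))%g) @^-1` A) = m A.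

Let mul (x y : bG) : bG := ((x : G) * (y : G))%g.
Let inv (x : bG) : bG := ((x : G)^-1)%g.

Let mmul (d : measure_display) (T : measurableType d) (f g : T -> bG) :
  measurable_fun setT f -> measurable_fun setT g ->
  measurable_fun setT (fun t => mul (f t) (g t)).
Proof.
move=> mf mg.
exact: (measurableT_comp (mulg_measurable_fun sG) (measurable_fun_pair mf mg)).
Qed.

Let minv (d : measure_display) (T : measurableType d) (f : T -> bG) :
  measurable_fun setT f -> measurable_fun setT (fun t => inv (f t)).
Proof.
move=> mf; apply: (@measurableT_comp _ _ _ _ _ _ inv) mf.
by apply: (@continuous_borelG G monoid.inv); exact: invg_continuous.
Qed.

Lemma haar_integral_mull (g : G) (h : bG -> \bar R) :
  measurable_fun setT h -> (forall x, 0 <= h x) ->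
  \int[m]_x h (mul g x) = \int[m]_x h x.
Proof.
move=> mh h0.
have mg : measurable_fun setT (mul g) by apply: mmul.
rewrite -[LHS](@ge0_integral_pushforward _ _ _ _ _ _ mg m setT h)//.
by apply: eq_measure_integral => A mA _; exact: m_inv.
Qed.

(** For [phi] the indicator of [A], [rconv phi l] is the mass of the translate
[A l^-1]; [rint] is the right-invariant integral obtained by inversion. *)
Definition rconv (phi : bG -> \bar R) (z : bG) := \int[m]_x phi (mul x z).
Definition rint (psi : bG -> \bar R) := \int[m]_z psi (inv z).

Section nonneg.
Variables (phi psi : bG -> \bar R).
Hypotheses (mphi : measurable_fun setT phi) (phi0 : forall x, 0 <= phi x).
Hypotheses (mpsi : measurable_fun setT psi) (psi0 : forall x, 0 <= psi x).

Lemma rconv_ge0 z : 0 <= rconv phi z.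
Proof. by apply: integral_ge0 => x _. Qed.

Lemma measurable_rconv : measurable_fun setT (rconv phi).
Proof.
apply: (@measurable_fun_fubini_tonelli_G _ _ _ _ _ m (fun p => phi (mul p.1 p.2))) => //.
by apply: measurableT_comp mphi _; apply: mmul.
Qed.

(** Both sides are the double integral of [psi z * phi (x z)]: Tonelli's theorem
and left invariance, used twice, separate the variables. *)
Lemma haar_rconv : \int[m]_x phi x * rint psi = \int[m]_z (psi z * rconv phi z).
Proof.
transitivity (\int[m]_z \int[m]_x (psi z * phi (mul x z))); last first.
  apply: eq_integral => z _; rewrite ge0_integralZl//.
  by apply: measurableT_comp mphi _; apply: mmul.
rewrite (@fubini_tonelli _ _ _ _ _ m m (fun p => psi p.1 * phi (mul p.2 p.1)))//; last 2 first.
- apply: emeasurable_funM; first exact: measurableT_comp.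
  by apply: measurableT_comp mphi _; apply: mmul.
- by move=> p; rewrite mule_ge0.
transitivity (\int[m]_y \int[m]_x (psi (mul (inv y) x) * phi x)); last first.
  apply: eq_integral => y _.
  rewrite -(haar_integral_mull (inv y) (h := fun x => psi x * phi (mul y x))).
  - by apply: eq_integral => x _; rewrite /mul /inv mulVKg.
  - apply: emeasurable_funM => //.
    by apply: measurableT_comp mphi _; apply: mmul.
  - by move=> x; rewrite mule_ge0.
rewrite (@fubini_tonelli _ _ _ _ _ m m (fun p => psi (mul (inv p.1) p.2) * phi p.2))//; last 2 first.
- apply: emeasurable_funM; last exact: measurableT_comp.
  by apply: measurableT_comp mpsi _; apply: mmul => //; apply: minv.
- by move=> p; rewrite mule_ge0.
rewrite -ge0_integralZr//; last by apply: integral_ge0.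
apply: eq_integral => x _ /=; rewrite ge0_integralZr//; last first.
  by apply: measurableT_comp mpsi _; apply: mmul => //; apply: minv.
rewrite muleC; congr (_ * _).
rewrite /rint -(haar_integral_mull (inv x) (h := fun y => psi (inv y))).
- by apply: eq_integral => y _; rewrite /mul /inv invgM invgK.
- by apply: measurableT_comp mpsi _; apply: minv.
- by [].
Qed.

Lemma rint_mulr (l : G) : rint (fun z => psi (mul z l)) = rint psi.
Proof.
rewrite /rint -[RHS](haar_integral_mull (l^-1)%g (h := fun y => psi (inv y))).
- by apply: eq_integral => y _; rewrite /mul /inv invgM invgK.
- by apply: measurableT_comp mpsi _; apply: minv.
- by [].
Qed.

End nonneg.

Lemma rconv_mulr phi l z : rconv (fun x => phi (mul x l)) z = rconv phi (mul z l).
Proof. by apply: eq_integral => x _; rewrite /mul mulgA. Qed.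

Lemma haar_rconv_mulr phi psi (l : G) :
  measurable_fun setT phi -> (forall x, 0 <= phi x) ->
  measurable_fun setT psi -> (forall x, 0 <= psi x) ->
  rconv phi l * rint psi = \int[m]_z (psi z * rconv phi (mul z l)).
Proof.
move=> mphi phi0 mpsi psi0.
have mphil : measurable_fun setT (fun x => phi (mul x l)).
  by apply: measurableT_comp mphi _; apply: mmul.
have -> := haar_rconv mphil (fun x => phi0 _) mpsi psi0.
by apply: eq_integral => z _; rewrite rconv_mulr.
Qed.

(** Uniqueness of Haar measure in disguise. Applied to [phi] and to its right
translates, [haar_rconv] turns one of the factors [\int phi] into [rconv phi l],
the other one into [rconv phi l^-1], and brings back the auxiliary factor [X],
which [haar_mulrV] cancels for a suitable [psi]. *)
Lemma rconvV phi psi (l : G) :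
  measurable_fun setT phi -> (forall x, 0 <= phi x) ->
  measurable_fun setT psi -> (forall x, 0 <= psi x) ->
  let X := rint (fun z => psi z * rconv phi z) in
  (\int[m]_x phi x * \int[m]_x phi x) * X = (rconv phi l * rconv phi (l^-1)%g) * X.
Proof.
move=> mphi phi0 mpsi psi0 X.
have mD := measurable_rconv mphi phi0.
have D0 := rconv_ge0 phi0.
have mM (k : G) (f : bG -> \bar R) : measurable_fun setT f -> measurable_fun setT (fun z : bG => f (mul z k)).
  move=> mf; apply: (@measurableT_comp _ _ _ _ _ _ f _ (fun z => mul z k)) => //.
  by apply: mmul.
transitivity (\int[m]_x phi x * \int[m]_z (psi (mul z l) * rconv phi (mul z l) * rconv phi z)).
  rewrite -muleA; congr (_ * _).
  have h0 z : 0 <= psi z * rconv phi z by rewrite mule_ge0.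
  have mh : measurable_fun setT (fun z => psi z * rconv phi z).
    exact: emeasurable_funM.
  have := @haar_rconv phi _ mphi phi0 (mM l _ mh) (fun z => h0 (mul z l)).
  by rewrite (rint_mulr mh h0 l).
have -> : \int[m]_z (psi (mul z l) * rconv phi (mul z l) * rconv phi z) =
    rconv phi l * rint (fun z => psi z * rconv phi (mul z l^-1%g)).
  have h0 z : 0 <= psi z * rconv phi (mul z l^-1%g) by rewrite mule_ge0.
  have mh : measurable_fun setT (fun z => psi z * rconv phi (mul z l^-1%g)).
    by apply: emeasurable_funM => //; exact: mM.
  rewrite -(rint_mulr mh h0 l).
  rewrite (haar_rconv_mulr l mphi phi0 (mM l _ mh) (fun z => h0 (mul z l))).
  apply: eq_integral => z _.
  have -> : mul (mul z l) l^-1%g = z by rewrite /mul -mulgA mulgV mulg1.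
  by rewrite -muleA [_ * rconv phi z]muleC muleA.
suff E : \int[m]_x phi x * rint (fun z => psi z * rconv phi (mul z l^-1%g)) =
    rconv phi l^-1%g * X by rewrite muleCA E muleA.
have h0 z : 0 <= psi z * rconv phi (mul z l^-1%g) by rewrite mule_ge0.
have mh : measurable_fun setT (fun z => psi z * rconv phi (mul z l^-1%g)).
  by apply: emeasurable_funM => //; exact: mM.
rewrite (haar_rconv mphi phi0 mh h0).
have k0 z : 0 <= psi z * rconv phi z by rewrite mule_ge0.
have mk : measurable_fun setT (fun z => psi z * rconv phi z).
  exact: emeasurable_funM.
rewrite (haar_rconv_mulr _ mphi phi0 mk k0).
by apply: eq_integral => z _; rewrite -!muleA [rconv _ _ * _]muleC.
Qed.

(** Right translation by [l] multiplies a left-invariant measure by a constant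
depending multiplicatively on [l], so the constants of [l] and [l^-1] cancel.
Taking for [psi] the indicator of [A^-1] makes the factor [X] of [rconvV] finite
and positive. *)
Lemma haar_mulrV (A : set G) (l : G) : hausdorff_space G -> compact A ->
  (forall K : set G, compact K -> m (K : set bG) < +oo) -> 0 < m (A : set bG) ->
  m ((fun x : bG => mul x l) @^-1` A) * m ((fun x : bG => mul x l^-1%g) @^-1` A)
  = m (A : set bG) * m (A : set bG).
Proof.
move=> hG cA mK mA0.
have mA : measurable (A : set bG) by exact: compact_borelG.
pose phi : bG -> \bar R := fun x => (\1_(A : set bG) x)%:E.
have mphi : measurable_fun setT phi.
  by apply/measurable_EFinP; exact: measurable_indic.
have phi0 x : 0 <= phi x by rewrite lee_fin.
have mmulr (k : G) : measurable_fun setT (fun x : bG => mul x k) by apply: mmul.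
have mpre (k : G) : measurable ((fun x : bG => mul x k) @^-1` A).
  by rewrite -[X in measurable X]setTI; exact: mmulr.
have phiE k : rconv phi k = m ((fun x : bG => mul x k) @^-1` A).
  transitivity (\int[m]_x (\1_((fun x : bG => mul x k) @^-1` A) x)%:E).
    by [].
  by rewrite integral_indic// setIT.
have phiT : \int[m]_x phi x = m (A : set bG) by rewrite integral_indic// setIT.
pose B := invgset A.
have cB : compact B by exact: compact_invgset.
have mB : measurable (B : set bG) by exact: compact_borelG.
pose psi : bG -> \bar R := fun x => (\1_(B : set bG) x)%:E.
have mpsi : measurable_fun setT psi.
  by apply/measurable_EFinP; exact: measurable_indic.
have psi0 x : 0 <= psi x by rewrite lee_fin.
pose D := rconv phi; pose X := rint (fun z => psi z * D z).
have mD := measurable_rconv mphi phi0.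
have D0 z : 0 <= D z := rconv_ge0 phi0 z.
have mpD : measurable_fun setT (fun z => psi z * D z) by exact: emeasurable_funM.
have pD0 z : 0 <= psi z * D z by rewrite mule_ge0.
have X0 : 0 <= X by apply: integral_ge0 => z _; rewrite mule_ge0.
have rpsi : rint psi = m (A : set bG).
  transitivity (\int[m]_z phi z) => //; apply: eq_integral => z _.
  rewrite /psi /phi !indicE; congr (_%:R%:E); congr nat_of_bool.
  apply/idP/idP; rewrite !inE; last by exists z.
  by case=> a Aa /(congr1 (fun t : G => t^-1)%g); rewrite !invgK => <-.
have DB z : B z -> D z <= m (mulgset A A : set bG).
  move=> [a Aa <-]; rewrite /D phiE le_measure ?inE//.
    by apply: compact_borelG => //; exact: compact_mulgset.
  by move=> x /= Axa; exists (x * a^-1)%g => //; exists a => //; rewrite -mulgA mulVg mulg1.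
have psiDE : m (A : set bG) * X = \int[m]_z (psi z * D z * D z).
  by rewrite -phiT (haar_rconv mphi phi0 mpD pD0).
have mAfin : m (A : set bG) \is a fin_num.
  by rewrite ge0_fin_numE ?mK.
have mAAfin : m (mulgset A A : set bG) \is a fin_num.
  by rewrite ge0_fin_numE// mK//; exact: compact_mulgset.
have Xfin : X \is a fin_num.
  rewrite ge0_fin_numE// -(@lte_pmul2l _ (m (A : set bG)))//.
  rewrite gt0_muley// psiDE.
  apply: (@le_lt_trans _ _ (\int[m]_z (psi z *
    (m (mulgset A A : set bG) * m (mulgset A A : set bG))))).
    apply: ge0_le_integral => //.
    - by move=> z _; rewrite mule_ge0.
    - exact: emeasurable_funM.
    - exact: emeasurable_funM.
    - move=> z _; rewrite -muleA; have [Bz|Bz] := pselect (B z).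
        by rewrite lee_wpmul2l// lee_pmul// DB.
      by rewrite /psi indicE memNset// !mul0e.
  rewrite ge0_integralZr ?mule_ge0// /psi integral_indic// setIT.
  by rewrite -ge0_fin_numE ?mule_ge0// !fin_numM// ge0_fin_numE// mK.
have Xpos : 0 < X.
  rewrite lt_def X0 andbT; apply/eqP => Xz.
  move: psiDE; rewrite Xz mule0 => /esym psiDD.
  have mpDD : measurable_fun setT (fun z => psi z * D z * D z) by exact: emeasurable_funM.
  have : \int[m]_z `|psi z * D z * D z| = 0.
    by rewrite -psiDD; apply: eq_integral => z _; rewrite gee0_abs// mule_ge0.
  move=> /(ae_eq_integral_abs m measurableT mpDD) h.
  have : \int[m]_z `|psi z * D z| = 0.
    apply/(ae_eq_integral_abs m measurableT mpD); apply: filterS h => z /= h _.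
    by have /eqP := h I; rewrite mule_eq0 => /orP[/eqP //|/eqP ->]; rewrite mule0.
  under eq_integral do rewrite gee0_abs//.
  rewrite -(haar_rconv mphi phi0 mpsi psi0) phiT rpsi => /eqP.
  by rewrite mule_eq0 orbb => /eqP e; rewrite e ltxx in mA0.
have := rconvV l mphi phi0 mpsi psi0; rewrite -/X phiT !phiE => e.
apply/eqP; rewrite eq_le -(lee_pmul2r Xfin Xpos) -[X in _ && X](lee_pmul2r Xfin Xpos).
by rewrite e !lexx.
Qed.

End Haar.

(** * Measurability on the hull *)
Section FellTranslation.
Variable G : topologicalGroupType.

Lemma fell_miss_open (K : set G) : compact K -> open (fell_miss K).
Proof.
move=> cK; exists [set fell_miss K]; last by rewrite bigcup_set1.
move=> _ ->; exists [fset fell_miss K]%fset.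
  by move=> A /fset1P ->; apply/mem_set; left; exists K.
by rewrite set_fset1 bigcap_set1.
Qed.

Lemma fell_hit_open (V : set G) : open V -> open (fell_hit V).
Proof.
move=> oV; exists [set fell_hit V]; last by rewrite bigcup_set1.
move=> _ ->; exists [fset fell_hit V]%fset.
  by move=> A /fset1P ->; apply/mem_set; right; exists V.
by rewrite set_fset1 bigcap_set1.
Qed.

Lemma ltrans_continuous (g : G) : continuous (@ltrans G g).
Proof.
apply/continuousP => O [D' sD <-]; rewrite preimage_bigcup.
apply: bigcup_open => _ /sD[F FS <-].
rewrite preimage_bigcap bigcap_fset big_seq.
elim/big_ind : _ => [|A B ? ?|A /FS /set_mem]; first exact: openT.
  exact: openI.
move=> [[K cK <-]|[V oV <-]].
  have -> : @ltrans G g @^-1` fell_miss K = fell_miss (translate g^-1%g K).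
    apply/seteqP; split=> C; rewrite /fell_miss /= => CK;
      apply/seteqP; split=> // x [].
      move=> Cx [y Ky xy]; suff : (translate g C `&` K) y by rewrite CK.
      by split=> //; exists x => //; rewrite -xy mulVKg.
    move=> [y Cy <-] Kgy; suff : ((C : set G) `&` translate g^-1%g K) y by rewrite CK.
    by split=> //; exists (g * y)%g => //; rewrite mulKg.
  by apply: fell_miss_open; exact: compact_translate.
have -> : @ltrans G g @^-1` fell_hit V = fell_hit ((fun x => g * x)%g @^-1` V).
  apply/seteqP; split=> C; rewrite /fell_hit /=.
    by move=> [_ [[x Cx <-] Vx]]; exists x.
  by move=> [x [Cx Vx]]; exists (g * x)%g; split => //; exists x.
apply: fell_hit_open; apply: open_comp => // x _; exact: mulgl_continuous.
Qed.

End FellTranslation.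

Lemma ge0_integral_mrestr d (T : measurableType d) (R : realType)
    (mu : {measure set T -> \bar R}) (A : set T) (mA : measurable A)
    (f : T -> \bar R) : measurable_fun setT f -> (forall x, (0 <= f x)%E) ->
  (\int[mrestr mu mA]_x f x = \int[mu]_(x in A) f x)%E.
Proof.
move=> mf f0; have mfS B : measurable_fun B f := measurable_funTS mf.
have mnA : measurable (~` A) by exact: measurableC.
transitivity (\int[mrestr mu mA]_(x in A `|` ~` A) f x)%E; first by rewrite setUv.
rewrite (ge0_integral_setU _ mA mnA (mfS _) (fun x _ => f0 x)); last first.
  by apply/disj_setPCl.
have -> : (\int[mrestr mu mA]_(x in ~` A) f x = 0)%E.
  apply: null_set_integral => //.
  by change (mu (~` A `&` A) = 0%E); rewrite setICl measure0.
rewrite adde0; apply: eq_measure_integral => B mB BA.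
by change (mu (B `&` A) = mu B); rewrite setIidl.
Qed.

Section HullMeasurability.
Variables (R : realType) (G : topologicalGroupType) (L : set G).
Local Notation bG := (borelG G).
Local Notation Om := (borel_hull L).

Definition pts (P : Om) : set G := closed_set (hull_set (P : ext_hull L)).

Definition hits (A : set G) : set Om := [set P | pts P `&` A !=set0].

Definition act (g : G) (P : Om) : Om := hull_act g (P : ext_hull L).

Lemma pts_act g P : pts (act g P) = translate g (pts P).
Proof. by []. Qed.

Lemma pts_inj P Q : pts P = pts Q -> P = Q.
Proof.
case: P => -[A cA] hA; case: Q => -[B cB] hB; rewrite /pts /= => e.
move: cA hA; rewrite e => cA; rewrite (Prop_irrelevance cA cB) => hA.
by rewrite (Prop_irrelevance hA hB).
Qed.

Lemma actE1 P : act 1%g P = P.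
Proof.
apply: pts_inj; rewrite pts_act; apply/seteqP; split=> [_ [x Px <-]|x Px].
  by rewrite mul1g.
by exists x => //; rewrite mul1g.
Qed.

Lemma actM g h P : act (g * h)%g P = act g (act h P).
Proof.
apply: pts_inj; rewrite !pts_act; apply/seteqP; split=> [_ [x Px <-]|_ [_ [x Px <-] <-]].
  by exists (h * x)%g; [exists x|rewrite mulgA].
by exists x => //; rewrite mulgA.
Qed.

Lemma measurable_act g : measurable_fun setT (act g).
Proof.
apply: (@measurability _ _ _ Om _ _ (@open (ext_hull L))) => //.
move=> _ [_ [W oW <-] <-]; rewrite setTI; apply: sub_sigma_algebra.
exists (@ltrans G g @^-1` W) => //.
by apply: open_comp => // x _; exact: ltrans_continuous.
Qed.

Lemma measurable_hits_open (A : set G) : open A -> measurable (hits A).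
Proof.
move=> oA; apply: sub_sigma_algebra.
by exists (fell_hit A) => //; exact: fell_hit_open.
Qed.

Lemma hits_bigcup (F : nat -> set G) : hits (\bigcup_n F n) = \bigcup_n hits (F n).
Proof.
apply/seteqP; split=> [P [x [Px [n _ Fx]]]|P [n _ [x [Px Fx]]]].
  by exists n => //; exists x.
by exists x; split => //; exists n.
Qed.

Section Cells.
Variable U : nat -> set G.
Hypotheses (Uo : forall j, open (U j))
  (Us : forall (P : Om) j x y, pts P x -> pts P y -> U j x -> U j y -> x = y)
  (Uc : forall x, exists j, U j x).

(** A member of the hull has at most one point in [U j]. So hitting the part of
[U j] outside [B] means hitting [U j] but not its part in [B], and the sets [A]
for which hitting [U j] inside [A] is measurable form a sigma-algebra. *)
Lemma measurable_hits_small j (A : set G) : measurable (A : set bG) ->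
  measurable (hits (U j `&` A)).
Proof.
suff h : <<s (@open G) >> `<=` [set A : set bG | measurable (hits (U j `&` A))].
  by move=> mA; exact: (h A mA).
apply: smallest_sub; last first.
  by move=> B oB /=; apply: measurable_hits_open; exact: openI.
split => /=.
- rewrite setI0 (_ : hits set0 = set0)//.
  by apply/seteqP; split=> // P [x []].
- move=> B mB; have -> : hits (U j `&` ([set: G] `\` B)) = hits (U j) `\` hits (U j `&` B).
    apply/seteqP; split=> P.
      move=> [x [Px [Ux [_ nBx]]]]; split; first by exists x.
      by move=> [y [Py [Uy By]]]; apply: nBx; rewrite (Us Px Py Ux Uy).
    move=> [[x [Px Ux]] nB]; exists x; split => //; split => //; split => // Bx.
    by apply: nB; exists x.
  by apply: measurableD => //; exact: measurable_hits_open.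
- move=> F mF; rewrite setI_bigcupr hits_bigcup.
  by apply: bigcupT_measurable => n; exact: mF.
Qed.

(** The cells are a Borel partition of [G] such that each member of the hull has
at most one point in each cell; [sel j P] is this point. *)
Definition cell j : set G := seqDU U j.

Lemma measurable_cell j : measurable (cell j : set bG).
Proof.
apply: measurableD; first exact: open_borelG.
by apply: bigsetU_measurable => k _; exact: open_borelG.
Qed.

Lemma cell_bigcup : \bigcup_j cell j = [set: G].
Proof.
rewrite -seqDU_bigcup_eq; apply/seteqP; split=> // x _.
by have [j Ux] := Uc x; exists j.
Qed.

Lemma cell_cover x : exists j, cell j x.
Proof. by have : [set: G] x by []; rewrite -cell_bigcup => -[j _]; exists j. Qed.

Lemma cell_pts P j x y : pts P x -> pts P y -> cell j x -> cell j y -> x = y.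
Proof.
move=> Px Py xj yj.
exact: Us Px Py (@subset_seqDU _ U j x xj) (@subset_seqDU _ U j y yj).
Qed.

Lemma measurable_hits (A : set G) : measurable (A : set bG) -> measurable (hits A).
Proof.
move=> mA; have -> : A = \bigcup_j (U j `&` (cell j `&` A)).
  apply/seteqP; split=> [x Ax|x [j _ [_ []]]//].
  have [j xj] := cell_cover x; exists j => //; split => //.
  exact: (@subset_seqDU _ U j x xj).
rewrite hits_bigcup; apply: bigcupT_measurable => j.
by apply: measurable_hits_small; apply: measurableI => //; exact: measurable_cell.
Qed.

Definition sel j (P : Om) : bG := xget (1%g : G) (pts P `&` cell j).

Lemma selP j P : hits (cell j) P -> (pts P `&` cell j) (sel j P).
Proof. by move=> [x Px]; rewrite /sel; apply: (@xgetPex _ _ (_ `&` _)); exists x. Qed.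

Lemma selE j P x : pts P x -> cell j x -> sel j P = x.
Proof.
move=> Px xj; have [Py yj] : (pts P `&` cell j) (sel j P) by apply: selP; exists x.
exact: cell_pts Py Px yj xj.
Qed.

Lemma measurable_sel j : measurable_fun setT (sel j).
Proof.
move=> _ A mA; rewrite setTI.
have -> : sel j @^-1` A = hits (cell j `&` A) `|`
    (if `[< A (1%g : G) >] then ~` hits (cell j) else set0).
  apply/seteqP; split=> P.
    rewrite /= => sA; have [h|h] := pselect (hits (cell j) P).
      by left; have [Px xj] := selP h; exists (sel j P).
    right; rewrite ifT//; apply/asboolP; move: sA; rewrite /sel.
    by case: xgetP => // x _ Px; case: h; exists x.
  case=> [[x [Px [xj Ax]]]|]; first by rewrite /= (selE Px xj).
  case: asboolP => // A1 nh; rewrite /= /sel; case: xgetP => // x _ Px.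
  by case: nh; exists x.
apply: measurableU.
  by apply: measurable_hits; apply: measurableI => //; exact: measurable_cell.
case: asboolP => // _; apply: measurableC; apply: measurable_hits.
exact: measurable_cell.
Qed.

Variable nu : {measure set Om -> \bar R}.

Lemma esum_pts (P : Om) (h : G -> \bar R) : (forall x, 0 <= h x)%E ->
  (\esum_(x in pts P) h x = \sum_(j <oo) (if P \in hits (cell j) then h (sel j P) else 0))%E.
Proof.
move=> h0; have -> : pts P = \bigcup_j (pts P `&` cell j).
  by rewrite -setI_bigcupr cell_bigcup setIT.
rewrite nneseries_sum_bigcup//; last first.
  by apply: trivIset_setIl; exact: trivIset_seqDU.
apply: eq_eseriesr => j _; case: ifPn => [/set_mem hj|/negP nhj].
  have [Px xj] := selP hj.
  rewrite (_ : pts P `&` cell j = [set sel j P]) ?esum_set1//.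
  apply/seteqP; split=> [y [Py yj]|_ ->//].
  exact: cell_pts Py Px yj xj.
rewrite (_ : pts P `&` cell j = set0) ?esum_set0//.
by apply/seteqP; split=> // y Py; case: nhj; apply/mem_set; exists y.
Qed.

Lemma measurable_pairsel j : measurable_fun setT (fun P : Om => (P, sel j P) : Om * bG).
Proof. by apply: measurable_fun_pair => //; exact: measurable_sel. Qed.

Definition mhits (j : nat) := measurable_hits (measurable_cell j).

(** The Campbell measure is the sum over the cells of the images of [nu],
restricted to the event that the cell contains a point, under [P |-> (P, sel j
P)]. *)
Definition cellmu (j : nat) : {measure set (Om * bG) -> \bar R}.
Proof.
unshelve refine (pushforward (mrestr nu (mhits j)) (fun P : Om => (P, sel j P) : Om * bG)
  : {measure set (Om * bG) -> \bar R}).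
exact: measurable_pairsel.
Defined.

Definition campbell : {measure set (Om * bG) -> \bar R} := mseries cellmu 0.

Lemma campbell_integral (h : Om * bG -> \bar R) :
  measurable_fun setT h -> (forall z, 0 <= h z)%E ->
  (\int[campbell]_z h z = \int[nu]_P \esum_(x in pts P) h (P, x))%E.
Proof.
move=> mh h0.
have mhj j : measurable_fun setT (fun P : Om => h (P, sel j P)).
  exact: (measurableT_comp mh (measurable_pairsel j)).
rewrite ge0_integral_measure_series//.
transitivity (\sum_(j <oo) \int[nu]_P (if P \in hits (cell j) then h (P, sel j P) else 0))%E.
  apply: eq_eseriesr => j _.
  rewrite (ge0_integral_pushforward (measurable_pairsel j))//.
  rewrite preimage_setT ge0_integral_mrestr; [|exact: mhj|by move=> x; exact: h0].
  rewrite integral_mkcond.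
  by apply: eq_integral => P _; rewrite patchE.
rewrite -integral_nneseries//.
- by apply: eq_integral => P _; rewrite esum_pts.
- move=> j; apply: (measurable_fun_if measurableT) => //.
  + apply: (measurable_fun_bool true); rewrite setTI.
    rewrite (_ : _ @^-1` _ = hits (cell j)); first exact: mhits.
    by apply/seteqP; split=> P /=; [exact: set_mem|exact: mem_set].
  + exact: measurable_funTS.
- by move=> j P _; case: ifP.
Qed.

Lemma measurable_esum_pts (h : Om * bG -> \bar R) :
  measurable_fun setT h -> (forall z, 0 <= h z)%E ->
  measurable_fun setT (fun P : Om => \esum_(x in pts P) h (P, x))%E.
Proof.
move=> mh h0; apply: (eq_measurable_fun (fun P =>
  \sum_(j <oo | j \in xpredT) (if P \in hits (cell j) then h (P, sel j P) else 0))%E).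
  by move=> P _; rewrite esum_pts//; apply: eq_eseriesl.
apply: ge0_emeasurable_sum => [j P _ _|j _]; first by case: ifP.
apply: (measurable_fun_if measurableT) => //.
- apply: (measurable_fun_bool true); rewrite setTI.
  rewrite (_ : _ @^-1` _ = hits (cell j)); first exact: mhits.
  by apply/seteqP; split=> P /=; [exact: set_mem|exact: mem_set].
- apply: measurable_funTS.
  exact: (measurableT_comp mh (measurable_pairsel j)).
Qed.

End Cells.
End HullMeasurability.

(** * Classes of points *)
Section SumLemmas.
Context {R : realType}.

Lemma esum_subset (T : choiceType) (A B : set T) (h : T -> \bar R) :
  A `<=` B -> (forall x, 0 <= h x)%E -> (\esum_(x in A) h x <= \esum_(x in B) h x)%E.
Proof.
move=> AB h0; rewrite -(setIidr AB) esum_mkcondr.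
by apply: le_esum => x _; case: ifP.
Qed.

Lemma esumZl (T : choiceType) (A : set T) (c : R) (h : T -> \bar R) :
  0 <= c -> (forall x, 0 <= h x)%E ->
  (c%:E * (\esum_(x in A) h x) = \esum_(x in A) (c%:E * h x))%E.
Proof.
have le (d : R) (k : T -> \bar R) : 0 <= d -> (forall x, 0 <= k x)%E ->
    (\esum_(x in A) (d%:E * k x) <= d%:E * (\esum_(x in A) k x))%E.
  move=> d0 k0; apply: ge_ereal_sup => _ [X XA <-].
  rewrite -ge0_mule_fsumr// lee_wpmul2l ?lee_fin//.
  by apply: esum_ge; exists X.
move=> c0 h0; apply/eqP; rewrite eq_le le// andbT.
have [->|cn0] := eqVneq c 0.
  by rewrite mul0e esum_ge0// => x _; rewrite mul0e.
have cpos : 0 < c by rewrite lt_def cn0.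
have ci0 : 0 <= c^-1 by rewrite invr_ge0.
have ch0 x : (0 <= c%:E * h x)%E by rewrite mule_ge0// lee_fin.
rewrite -lee_pdivlMl//; apply: le_trans (le _ _ ci0 ch0).
by apply: le_esum => x _; rewrite muleA -EFinM mulVf// mul1e.
Qed.

Definition cnt (T : choiceType) (A : set T) : \bar R := (\esum_(x in A) 1)%E.

Lemma cnt_ge0 (T : choiceType) (A : set T) : (0 <= cnt A)%E.
Proof. exact: esum_ge0. Qed.

Lemma cntS (T : choiceType) (A B : set T) : A `<=` B -> (cnt A <= cnt B)%E.
Proof. by move=> AB; apply: esum_subset. Qed.

Lemma cnt_finite (T : choiceType) (A : set T) : finite_set A -> (cnt A < +oo)%E.
Proof.
move=> Af; rewrite /cnt esum_fset// fsbig_finite//=.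
by rewrite sumEFin ltry.
Qed.

Lemma cnt_image (T T' : choiceType) (f : T -> T') (A : set T) :
  set_inj A f -> cnt (f @` A) = cnt A.
Proof. by move=> fi; rewrite /cnt esum_image. Qed.

End SumLemmas.

(** The subgroup [H] is an arbitrary subgroup, while [Hm] is a Borel set that
cuts the same relation on the points of each member of the hull. *)
Section Classes.
Variables (R : realType) (G : topologicalGroupType) (L : set G).
Local Notation bG := (borelG G).
Local Notation Om := (borel_hull L).
Hypothesis sG : @second_countable G.
Variable U : nat -> set G.
Hypotheses (Uo : forall j, open (U j))
  (Us : forall (P : Om) j x y, pts P x -> pts P y -> U j x -> U j y -> x = y)
  (Uc : forall x, exists j, U j x).
Variables (H Hm : set G).
Hypotheses (Hgrp : is_subgroup H) (mHm : measurable (Hm : set bG))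
  (HmE : forall (P : Om) x y, pts P x -> pts P y -> Hm (x^-1 * y)%g <-> H (x^-1 * y)%g).

Local Notation "x ~~ y" := (H (x^-1 * y)%g) (at level 70).

Lemma class_refl x : x ~~ x.
Proof. by rewrite mulVg; case: Hgrp. Qed.

Lemma class_sym x y : x ~~ y -> y ~~ x.
Proof. by move=> xy; case: Hgrp => _ _ /(_ _ xy); rewrite invgM invgK. Qed.

Lemma class_trans y x z : x ~~ y -> y ~~ z -> x ~~ z.
Proof.
by move=> xy yz; case: Hgrp => _ /(_ _ _ xy yz) + _; rewrite -mulgA mulVKg.
Qed.

(** One representative for each class: the point in the cell of least index. It
is a measurable choice but not an equivariant one; [esum_transversal] makes up
for this. *)
Definition lead (P : Om) : set G := [set x | pts P x /\
  exists2 j, cell U j x & forall i y, (i < j)%N -> pts P y -> cell U i y -> ~ x ~~ y].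

(** At a point [x] of [P]: the class of [x] has a point in the cell [i]. The
auxiliary set [Hm] makes this a Borel condition. *)
Definition link i : set (Om * bG) := [set z : Om * bG | hits (cell U i) z.1 /\
  Hm ((z.2 : G)^-1 * (sel U i z.1 : G))%g].

Lemma linkP P i x y : pts P x -> pts P y -> cell U i y -> link i (P, x) <-> x ~~ y.
Proof.
move=> Px Py yi; rewrite /link /= (selE Us Py yi).
by split=> [[_ /(HmE Px Py)]//|xy]; split; [exists y|apply/(HmE Px Py)].
Qed.

Lemma link_sel P i x : pts P x -> link i (P, x) -> pts P (sel U i P) /\ x ~~ (sel U i P).
Proof. by move=> Px [/= /selP[Py _] /(HmE Px Py)]. Qed.

Lemma measurable_link i : measurable (link i).
Proof.
have -> : link i = (fst @^-1` (hits (cell U i) : set Om)) `&`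
  ((fun z : Om * bG => ((z.2 : G)^-1 * (sel U i z.1 : G))%g : bG) @^-1` Hm).
  by [].
apply: measurableI.
  by rewrite -[X in measurable X]setTI; apply: measurable_fst => //; exact: mhits.
rewrite -[X in measurable X]setTI.
have mf : measurable_fun setT (fun z : Om * bG => ((z.2 : G)^-1)%g : bG).
  apply: (@measurableT_comp _ _ _ _ _ _ (fun x : bG => (x : G)^-1%g : bG) _ snd) => //.
  exact: (@continuous_borelG G (fun x => x^-1%g) (@invg_continuous G)).
have ms : measurable_fun setT (fun z : Om * bG => sel U i z.1).
  by apply: (@measurableT_comp _ _ _ _ _ _ (sel U i) _ fst) => //; exact: measurable_sel.
exact: (measurableT_comp (mulg_measurable_fun sG) (measurable_fun_pair mf ms)).
Qed.

Definition leadM : set (Om * bG) := \bigcup_j ((setT `*` (cell U j : set bG)) `&`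
  \bigcap_(i in `I_j) ~` link i).

Lemma leadMP P x : pts P x -> leadM (P, x) <-> lead P x.
Proof.
move=> Px; split=> [[j _ [[_ /= xj] h]]|[_ [j xj h]]].
  split => //; exists j => // i y ij Py yi xy.
  by apply: (h i ij); apply/(linkP Px Py yi).
exists j => //; split => // i /= ij li.
have [Py xy] := link_sel Px li; have [/= /selP[_ yi] _] := li.
exact: (h i _ ij Py yi).
Qed.

Lemma measurable_leadM : measurable leadM.
Proof.
apply: bigcupT_measurable => j; apply: measurableI.
  by apply: measurableX => //; exact: measurable_cell.
apply: bigcap_measurableType => i _; apply: measurableC.
exact: measurable_link.
Qed.

Definition transversal (A : set G) (P : Om) : Prop := [/\ A `<=` pts P,
  forall x, pts P x -> exists2 y, A y & x ~~ y &
  forall x y, A x -> A y -> x ~~ y -> x = y].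

Lemma lead_transversal P : transversal (lead P) P.
Proof.
split; first by move=> x [].
- move=> x Px.
  have : exists j, `[< exists y, [/\ pts P y, cell U j y & x ~~ y] >].
    have [j xj] := cell_cover Uc x; exists j; apply/asboolP; exists x.
    by split => //; exact: class_refl.
  move=> /ex_minnP[j /asboolP[y [Py yj xy]] jmin].
  exists y => //; split => //; exists j => // i z ij Pz zi yz.
  have := jmin i; rewrite leqNgt ij => /(_ _)/negP; apply => //.
  by apply/asboolP; exists z; split => //; exact: class_trans xy yz.
- move=> x y [Px [i xi hx]] [Py [j yj hy]] xy.
  have [ij|ji|ij] := ltngtP i j.
  + by case: (hy i x ij Px xi); exact: class_sym.
  + by case: (hx j y ji Py yj).
  + by apply: (cell_pts Us Px Py xi); rewrite ij.
Qed.

Lemma esum_transversal (P : Om) (A B : set G) (h : G -> \bar R) :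
  transversal A P -> transversal B P ->
  (forall x y, pts P x -> pts P y -> x ~~ y -> h x = h y) ->
  (\esum_(x in A) h x = \esum_(x in B) h x)%E.
Proof.
move=> [AP Ae Au] [BP Be Bu] hinv.
have /choice[e eP] : forall x, exists y, A x -> B y /\ x ~~ y.
  move=> x; have [Ax|nAx] := pselect (A x); last by exists x.
  by have [y By xy] := Be x (AP _ Ax); exists y.
have eB : set_bij A B e.
  split.
  - by move=> x /eP[].
  - move=> x y /set_mem Ax /set_mem Ay exy; apply: Au => //.
    have [Bx xex] := eP x Ax; have [By yey] := eP y Ay.
    by apply: class_trans xex _; rewrite exy; exact: class_sym.
  - move=> y By; have [x Ax yx] := Ae y (BP _ By); exists x => //.
    have [Bx xex] := eP x Ax; apply: Bu => //; apply: class_sym.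
    exact: class_trans yx xex.
rewrite (@reindex_esum _ _ _ A B e h eB); apply: eq_esum => x Ax; have [Bx xex] := eP x Ax.
by apply: hinv => //; [exact: AP|exact: BP].
Qed.

Lemma transversal_translate (A : set G) P g :
  transversal A P -> transversal (translate g A) (act g P).
Proof.
have e x y : ((g * x)^-1 * (g * y) = x^-1 * y)%g by rewrite invgM -mulgA mulKg.
move=> [AP Ae Au]; split; rewrite ?pts_act.
- by move=> _ [x Ax <-]; exists x => //; exact: AP.
- move=> _ [x Px <-]; have [y Ay xy] := Ae x Px; exists (g * y)%g; first by exists y.
  by rewrite e.
- by move=> _ _ [x Ax <-] [y Ay <-]; rewrite e => /(Au x y Ax Ay) ->.
Qed.

Variable nu : {measure set Om -> \bar R}.
Hypothesis nu_inv : forall (g : G) (A : set Om), measurable A ->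
    nu (act g @^-1` A) = nu A.

Local Notation cmu := (campbell Uo Us Uc nu).

Lemma nu_integral_act (g : G) (F : Om -> \bar R) : measurable_fun setT F ->
  (forall P, 0 <= F P)%E -> (\int[nu]_P F (act g P) = \int[nu]_P F P)%E.
Proof.
move=> mF F0.
have mg := @measurable_act G L g.
rewrite -[LHS](@ge0_integral_pushforward _ _ _ _ _ _ mg nu setT F)//.
by apply: eq_measure_integral => A mA _; exact: nu_inv.
Qed.

Definition class_inv T (w : Om * bG -> T) : Prop := forall (P : Om) (x y : G),
  pts P x -> pts P y -> x ~~ y -> w (P, x) = w (P, y).

Definition gmul (g : G) (z : Om * bG) : Om * bG := (act g z.1, (g * (z.2 : G))%g).

Lemma measurable_gmul g : measurable_fun setT (gmul g).
Proof.
apply: measurable_fun_pair.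
  by apply: (@measurableT_comp _ _ _ _ _ _ (act g) _ fst) => //; exact: measurable_act.
apply: (@measurableT_comp _ _ _ _ _ _ (fun x : bG => (g * (x : G))%g : bG) _ snd) => //.
by apply: (@continuous_borelG G (fun x => g * x)%g); exact: mulgl_continuous.
Qed.

Lemma class_inv_gmul T g (w : Om * bG -> T) : class_inv w -> class_inv (w \o gmul g).
Proof.
move=> wi P x y Px Py xy; apply: wi; rewrite ?pts_act; [by exists x|by exists y|].
by rewrite /= invgM -mulgA mulKg.
Qed.

Lemma esum_lead (P : Om) (h : Om * bG -> \bar R) :
  (\esum_(x in lead P) h (P, x) = \esum_(x in pts P) (h \_ leadM) (P, x))%E.
Proof.
have -> : lead P = pts P `&` lead P by rewrite setIidr// => x [].
rewrite esum_mkcondr; apply: eq_esum => x Px; rewrite patchE.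
case: ifPn => [xl|/negP nl].
  by rewrite mem_set//; apply/(leadMP Px)/set_mem.
by rewrite memNset// => /(leadMP Px) xl; apply: nl; exact: mem_set.
Qed.

Lemma measurable_esum_lead (h : Om * bG -> \bar R) :
  measurable_fun setT h -> (forall z, 0 <= h z)%E ->
  measurable_fun setT (fun P => \esum_(x in lead P) h (P, x))%E.
Proof.
move=> mh h0; under eq_fun do rewrite esum_lead.
apply: measurable_esum_pts => //.
  exact/(measurable_restrictT _ measurable_leadM)/measurable_funTS.
by move=> z; rewrite patchE; case: ifP.
Qed.

Lemma class_integral (h : Om * bG -> \bar R) : measurable_fun setT h ->
  (forall z, 0 <= h z)%E ->
  (\int[cmu]_(z in leadM) h z = \int[nu]_P \esum_(x in lead P) h (P, x))%E.
Proof.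
move=> mh h0; rewrite integral_mkcond campbell_integral; last 2 first.
- exact/(measurable_restrictT _ measurable_leadM)/measurable_funTS.
- by move=> z; rewrite patchE; case: ifP.
by apply: eq_integral => P _; rewrite esum_lead.
Qed.

(** Translation by [g] maps the leading points of [P] to a transversal of the
classes of [g P], and a sum over the classes does not see which transversal is
used. *)
Lemma class_integral_gmul g (h : Om * bG -> \bar R) : measurable_fun setT h ->
  (forall z, 0 <= h z)%E -> class_inv h ->
  (\int[cmu]_(z in leadM) h (gmul g z) = \int[cmu]_(z in leadM) h z)%E.
Proof.
move=> mh h0 hinv; rewrite !class_integral//; last first.
  exact: (measurableT_comp mh (measurable_gmul g)).
pose F P := (\esum_(x in lead P) h (P, x))%E.
have mF : measurable_fun setT F by exact: measurable_esum_lead.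
have F0 P : (0 <= F P)%E by apply: esum_ge0.
rewrite -(nu_integral_act g mF F0); apply: eq_integral => P _.
rewrite /F -(esum_transversal (transversal_translate g (lead_transversal P)) (lead_transversal _)).
  rewrite /translate esum_image//.
  by move=> x y _ _; exact: mulgI.
by move=> x y Px Py xy; exact: hinv.
Qed.

(** A class function is constant on each class and comes out of the inner sum. *)
Lemma esum_regroup (P : Om) (h : G -> R) (c : G -> \bar R) :
  (forall x, 0 <= h x) -> (forall x, 0 <= c x)%E ->
  (forall x y, pts P x -> pts P y -> x ~~ y -> h x = h y) ->
  (\esum_(x in pts P) ((h x)%:E * c x) =
   \esum_(y in lead P) ((h y)%:E * (\esum_(x in [set x | pts P x /\ y ~~ x]) c x)))%E.
Proof.
move=> h0 c0 hinv; have [lP le lu] := lead_transversal P.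
pose J (y : G) := [set x | pts P x /\ y ~~ x].
transitivity (\esum_(y in lead P) \esum_(x in J y) ((h x)%:E * c x))%E; last first.
  apply: eq_esum => y yl; rewrite esumZl//; apply: eq_esum => x [Px yx].
  by rewrite (hinv y x)//; exact: lP.
rewrite esum_esum; last by move=> *; rewrite mule_ge0 ?lee_fin.
rewrite (@reindex_esum _ _ _ (lead P `*`` J) (pts P) snd)//; split.
- by move=> [y x] [/= _ []].
- move=> [y x] [y' x'] /set_mem[/= yl [Px yx]] /set_mem[/= yl' [Px' yx']] /= xx'.
  subst x'; congr pair; apply: lu => //; apply: (class_trans yx).
  exact: class_sym.
- move=> x Px; have [y yl xy] := le x Px; exists (y, x) => //; split => //=.
  by split => //; exact: class_sym.
Qed.

(** * The representation on class functions *)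
Definition gact (g : G) (w : Om * bG -> R) : Om * bG -> R := w \o gmul g^-1%g.
Arguments gact g%_g w%_R.

Lemma gmul1 z : gmul 1%g z = z.
Proof. by case: z => P x; rewrite /gmul /= actE1 mul1g. Qed.

Lemma gmulM g h z : gmul (g * h)%g z = gmul g (gmul h z).
Proof. by rewrite /gmul /= actM mulgA. Qed.

Lemma gact1 w : gact 1%g w = w.
Proof. by apply/funext => z; rewrite /gact /= invg1 gmul1. Qed.

Lemma gactM g h w : gact (g * h)%g w = gact g (gact h w).
Proof. by apply/funext => z; rewrite /gact /= invgM gmulM. Qed.

Lemma gactB g u v : gact g (u - v) = gact g u - gact g v.
Proof. by []. Qed.

Lemma gact_lin g a u v : gact g (a *: u + v) = a *: gact g u + gact g v.
Proof. by []. Qed.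

Lemma measurable_gact g w : measurable_fun setT w -> measurable_fun setT (gact g w).
Proof. by move=> mw; exact: (measurableT_comp mw (measurable_gmul _)). Qed.

Lemma class_inv_gact g w : class_inv w -> class_inv (gact g w).
Proof. by move=> wi; exact: class_inv_gmul. Qed.

Lemma class_inv_lin a (u v : Om * bG -> R) : class_inv u -> class_inv v ->
  class_inv (a *: u + v).
Proof.
move=> ui vi P x y Px Py xy.
by change (a * u (P, x) + v (P, x) = a * u (P, y) + v (P, y)); rewrite (ui P x y)// (vi P x y).
Qed.

Lemma class_invB (u v : Om * bG -> R) : class_inv u -> class_inv v -> class_inv (u - v).
Proof.
move=> ui vi P x y Px Py xy.
by change (u (P, x) - v (P, x) = u (P, y) - v (P, y)); rewrite (ui P x y)// (vi P x y).
Qed.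

Definition sqn (w : Om * bG -> R) := sqint cmu leadM w.
Arguments sqn w%_R.

Lemma sqn_gact g w : measurable_fun setT w -> class_inv w -> sqn (gact g w) = sqn w.
Proof.
move=> mw wi; rewrite /sqn /sqint.
apply: (class_integral_gmul g^-1%g (h := fun z => (w z ^+ 2)%:E)).
- by apply/measurable_EFinP; exact: measurable_funX.
- by move=> z; rewrite lee_fin sqr_ge0.
- by move=> P x y Px Py xy; rewrite (wi P x y).
Qed.

Lemma sqnD (u v : Om * bG -> R) : measurable_fun setT u -> measurable_fun setT v ->
  (sqn (u + v) <= 2%:E * sqn u + 2%:E * sqn v)%E.
Proof.
move=> mu mv; have := sqint_lin cmu measurable_leadM 1 mu mv.
by rewrite scale1r expr1n mulr1.
Qed.

Lemma sqnN (u : Om * bG -> R) : sqn (- u) = sqn u.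
Proof. by apply: eq_integral => z _; rewrite -[(- u) z]/(- u z) sqrrN. Qed.

(** Strong continuity is imposed on the vectors; the vectors with a continuous
orbit form a closed invariant subspace. *)
Definition orbit_continuous (w : Om * bG -> R) : Prop :=
  forall e : R, 0 < e -> \forall g \near (1%g : G), (sqn (gact g w - w) <= e%:E)%E.

Definition is_vector (w : Om * bG -> R) : Prop :=
  [/\ L2fun cmu leadM w, class_inv w & orbit_continuous w].

Lemma is_vector0 : is_vector 0.
Proof.
split => //; first exact: L2fun0.
move=> e e0; apply: nearW => g; rewrite (_ : gact g 0 - 0 = 0); last first.
  by rewrite subr0.
by rewrite /sqn /sqint; under eq_integral do rewrite expr0n; rewrite integral0 lee_fin ltW.
Qed.

Lemma is_vector_lin a u v : is_vector u -> is_vector v -> is_vector (a *: u + v).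
Proof.
move=> [Lu ui uc] [Lv vi vc]; split; [exact: L2fun_lin measurable_leadM _ _ _ Lu Lv| |].
  exact: class_inv_lin.
move=> e e0.
have d0 : 0 < e / (4 * (a ^+ 2 + 1)).
  by rewrite divr_gt0// mulr_gt0// ltr_wpDl ?sqr_ge0.
have e40 : 0 < e / 4 by rewrite divr_gt0.
have mBu g : measurable_fun setT (gact g u - u).
  by apply: measurable_funB; [apply: measurable_gact|]; case: Lu.
have mBv g : measurable_fun setT (gact g v - v).
  by apply: measurable_funB; [apply: measurable_gact|]; case: Lv.
near=> g.
have -> : gact g (a *: u + v) - (a *: u + v) = a *: (gact g u - u) + (gact g v - v).
  by rewrite gact_lin scalerBr opprD addrACA.
apply: le_trans (sqint_lin cmu measurable_leadM a (mBu g) (mBv g)) _.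
have hu : (sqn (gact g u - u) <= (e / (4 * (a ^+ 2 + 1)))%:E)%E by near: g; exact: uc.
have hv : (sqn (gact g v - v) <= (e / 4)%:E)%E by near: g; exact: vc.
apply: (@le_trans _ _ ((2 * a ^+ 2)%:E * (e / (4 * (a ^+ 2 + 1)))%:E + 2%:E * (e / 4)%:E)%E).
  apply: leeD; last by rewrite lee_wpmul2l.
  by rewrite lee_wpmul2l// lee_fin mulr_ge0 ?sqr_ge0.
rewrite -!EFinM -EFinD lee_fin.
have -> : 2 * a ^+ 2 * (e / (4 * (a ^+ 2 + 1))) + 2 * (e / 4)
  = e / 2 * (a ^+ 2 / (a ^+ 2 + 1)) + e / 2.
  by field; rewrite gt_eqF// ltr_wpDl ?sqr_ge0.
have e2 : 0 <= e / 2 by rewrite divr_ge0// ltW.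
rewrite [leRHS]splitr lerD2r ler_piMr//.
by rewrite ler_pdivrMr ?mul1r ?lerDl// ltr_wpDl ?sqr_ge0.
Unshelve. all: by end_near. Qed.

Lemma is_vector_lim (u : nat -> Om * bG -> R) f : (forall n, is_vector (u n)) ->
  L2fun cmu leadM f ->
  (forall e : R, 0 < e -> exists N, forall n, (N <= n)%N ->
     (sqint cmu leadM (u n - f)%R <= e%:E)%E) ->
  (forall t t', (forall n, u n t = u n t') -> f t = f t') -> is_vector f.
Proof.
move=> uV Lf uf fP.
have fi : class_inv f.
  by move=> P x y Px Py xy; apply: fP => n; have [_ ui _] := uV n; exact: ui.
split => // e e0.
have e120 : 0 < e / 12 by rewrite divr_gt0.
have e80 : 0 < e / 8 by rewrite divr_gt0.
have [N hN] := uf _ e120; have {}hN := hN N (leqnn N).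
have [Lu ui uc] := uV N; have [mf _] := Lf; have [mu _] := Lu.
have mB : measurable_fun setT (f - u N) by exact: measurable_funB.
near=> g.
have -> : gact g f - f = gact g (f - u N) + ((gact g (u N) - u N) + (u N - f)).
  by rewrite gactB addrACA; apply/funext => z; rewrite !fctE; ring.
have mg : measurable_fun setT (gact g (u N) - u N).
  by apply: measurable_funB => //; exact: measurable_gact.
have mB' : measurable_fun setT (u N - f) by exact: measurable_funB.
apply: le_trans (sqnD (measurable_gact _ mB) (measurable_funD mg mB')) _.
have h1 : (sqn (gact g (f - u N)) <= (e / 12)%:E)%E.
  by rewrite sqn_gact//; [rewrite -opprB sqnN|exact: class_invB].
have h2 : (sqn (gact g (u N) - u N + (u N - f)) <= 2%:E * (e / 8)%:E + 2%:E * (e / 12)%:E)%E.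
  apply: le_trans (sqnD mg mB') _; apply: leeD; rewrite lee_wpmul2l//.
  by near: g; exact: uc.
apply: (@le_trans _ _ (2%:E * (e / 12)%:E +
    2%:E * (2%:E * (e / 8)%:E + 2%:E * (e / 12)%:E))%E).
  by apply: leeD; rewrite lee_wpmul2l.
rewrite -!EFinM -EFinD lee_fin.
by rewrite le_eqVlt; apply/orP; left; apply/eqP; field.
Unshelve. all: by end_near. Qed.

Lemma is_vector_L2 w : is_vector w -> L2fun cmu leadM w.
Proof. by case. Qed.

Definition vectors : L2subspace cmu leadM := @mkL2subspace _ _ _ _ _
  is_vector is_vector_L2 is_vector0 is_vector_lin is_vector_lim.

Lemma conjg_cvg1 (g : G) : (g^-1 * (h * g))%g @[h --> (1%g : G)] --> (1%g : G).
Proof.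
have c : continuous (fun h : G => (g^-1 * (h * g))%g).
  move=> h; apply: (@continuous_comp _ _ _ (fun h : G => (h * g)%g) (fun h : G => (g^-1 * h)%g)).
    exact: mulgr_continuous.
  exact: mulgl_continuous.
by have := c 1%g; rewrite /continuous_at /= mul1g mulVg.
Qed.

(** For the orbit of [gact g w] at [h], conjugate: it is the orbit of [w] at
[g^-1 h g], which tends to the identity with [h]. *)
Lemma is_vector_gact g w : is_vector w -> is_vector (gact g w).
Proof.
move=> [[mw wfin] wi wc]; split.
- split; first exact: measurable_gact.
  by rewrite -/(sqn _) sqn_gact.
- exact: class_inv_gact.
- move=> e e0.
  have H1 : \forall h \near (1%g : G),
      (sqn (gact (g^-1 * (h * g))%g w - w) <= e%:E)%E.
    exact: (@conjg_cvg1 g _ (wc e e0)).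
  apply: filterS H1 => h; rewrite -(@sqn_gact g (gact (g^-1 * (h * g))%g w - w)).
  - by rewrite gactB -!gactM mulVKg.
  - by apply: measurable_funB => //; exact: measurable_gact.
  - by apply: class_invB => //; exact: class_inv_gact.
Qed.

Local Notation V := (L2sub_semiHilbert measurable_leadM vectors).

Lemma rep_subproof g (w : L2sub vectors) : L2sub_pred vectors (gact g (L2sub_val w)).
Proof. by apply/asboolP; apply: is_vector_gact; exact: (L2subP w). Qed.

Definition rep (g : G) (w : V) : V := MkL2sub (rep_subproof g w).

Lemma V_sqn (w : V) : (sip w w)%:E = sqn (L2sub_val w).
Proof. exact: (L2sub_ip_sqint measurable_leadM w). Qed.

Lemma rep_linear g : linear (rep g).
Proof. by move=> a u v; apply: val_inj; exact: gact_lin. Qed.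

Lemma rep_orthogonal : orthogonal_representation rep.
Proof.
have rsq g w : sip (rep g w) (rep g w) = sip w w.
  apply/EFin_inj; rewrite !V_sqn; have [[mw _] wi _] := L2subP w.
  exact: sqn_gact.
split => //.
- exact: rep_linear.
- move=> g u v; have := rsq g (1 *: u + v).
  rewrite rep_linear !scale1r !sipDl !sipDr !rsq [sip v u]sipC [sip (rep g v) _]sipC.
  by move=> h; lra.
- by move=> u; apply: val_inj; exact: gact1.
- by move=> g h u; apply: val_inj; exact: gactM.
- move=> u e e0; have [_ _ uc] := L2subP u.
  have := uc (e / 2) (divr_gt0 e0 (ltr0Sn _ 1)); apply: filterS => g h.
  rewrite -lte_fin V_sqn; apply: le_lt_trans h _.
  by rewrite lte_fin ltr_pdivrMr// ltr_pMr// ltr1n.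
Qed.

Lemma property_T_vector (Q : set G) (eps : R) :
  (forall (X : semiHilbert R) (pi : G -> X -> X), orthogonal_representation pi ->
    forall u, 0 < sip u u ->
    (forall g, Q g -> sip (pi g u - u) (pi g u - u) < eps * sip u u) ->
    exists2 v, 0 < sip v v & forall g, sip (pi g v - v) (pi g v - v) = 0) ->
  forall u, is_vector u -> (0 < sqn u)%E ->
  (forall g, Q g -> (sqn (gact g u - u) < eps%:E * sqn u)%E) ->
  exists w, [/\ is_vector w, (0 < sqn w)%E & forall g, sqn (gact g w - w) = 0%E].
Proof.
move=> T u uV u0 hu.
have up : L2sub_pred vectors u by exact/asboolP.
have sqnB g (v : V) : (sip (rep g v - v) (rep g v - v))%:E = sqn (gact g (L2sub_val v) - L2sub_val v).
  exact: V_sqn.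
have [||v v0 vinv] := T V rep rep_orthogonal (MkL2sub up).
- by rewrite -lte_fin V_sqn.
- by move=> g Qg; rewrite -lte_fin EFinM sqnB V_sqn; exact: hu.
exists (L2sub_val v); split.
- exact: (L2subP v).
- by rewrite -V_sqn lte_fin.
- by move=> g; rewrite -sqnB vinv.
Qed.

End Classes.

(** * Bump functions and large compact sets *)
Section Bump.
Variables (R : realType) (T : topologicalType).
Hypotheses (hT : hausdorff_space T) (lT : locally_compact [set: T]).

Lemma bump_function_at (x : T) : exists2 V, nbhs x V &
  exists (phi : T -> R) (K' : set T), [/\ compact K', continuous phi,
    forall y, 0 <= phi y, forall y, V y -> 1 <= phi y &
    forall y, phi y <> 0 -> K' y].
Proof.
have [C nC [cC clC]] := compact_nbhs lT x.
have [||f [cf f01 f0 f1]] := (@uniform_separatorP _ R _ _).1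
    (@locally_compact_completely_regular T R lT hT x (~` C^°) _ _).
- by apply: open_closedC; exact: open_interior.
- by move=> /(_ nC).
have fx : f x = 0 by apply: f0; exists x.
have fI y : 0 <= f y <= 1 by have := f01 (f y) (ex_intro2 _ _ y I erefl); rewrite /= in_itv.
exists [set y | f y < 2^-1].
  have o : open [set t : R | t < 2^-1] by exact: open_lt.
  apply: (open_nbhs_nbhs (conj (open_comp (fun z _ => cf z) o) _)).
  by rewrite /= fx invr_gt0.
exists (fun y => 2 * (1 - f y)), C; split => //.
- by move=> y; apply: cvgMr; apply: cvgB; [exact: cvg_cst|exact: cf].
- by move=> y; have /andP[_ ?] := fI y; rewrite mulr_ge0// subr_ge0.
- by move=> y /= fy; lra.
- move=> y fy; apply: contrapT => nCy; apply: fy.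
  have -> : f y = 1 by apply: f1; exists y => //; apply: contra_not nCy; exact: interior_subset.
  by rewrite subrr mulr0.
Qed.

(** Finitely many local bumps are added, and the sum is truncated at 1. *)
Lemma bump_function (K : set T) : compact K ->
  exists (phi : T -> R) (K' : set T), [/\ compact K', continuous phi,
    forall x, 0 <= phi x <= 1, forall x, K x -> phi x = 1 &
    forall x, phi x <> 0 -> K' x].
Proof.
move=> cK.
pose P (A : set T) := exists (phi : T -> R) (K' : set T), [/\ compact K', continuous phi,
    forall x, 0 <= phi x, forall x, A x -> 1 <= phi x & forall x, phi x <> 0 -> K' x].
have [|A B|x Kx|A [phi [K' [cK' cphi phi0 phi1 phiK]]] KA] := @compact_cover_ind T P K cK.
- by exists (fun=> 0), set0; split => //; [exact: compact0|exact: cst_continuous].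
- move=> [phi [C [cC cphi phi0 phi1 phiC]]] [psi [D [cD cpsi psi0 psi1 psiD]]].
  exists (fun x => phi x + psi x), (C `|` D); split.
  + exact: compactU.
  + by move=> x; apply: cvgD; [exact: cphi|exact: cpsi].
  + by move=> x; rewrite addr_ge0.
  + by move=> x [/phi1 h|/psi1 h]; [rewrite ler_wpDr|rewrite ler_wpDl].
  + move=> x n0; have [p0|/eqP/phiC ?] := eqVneq (phi x) 0; last by left.
    by right; apply: psiD => q0; apply: n0; rewrite p0 q0 addr0.
- exact: bump_function_at.
exists (fun x => Num.min 1 (phi x)), K'; split => //.
- by move=> x; apply: continuous_min; [exact: cvg_cst|exact: cphi].
- by move=> x; rewrite le_min ler01 phi0 ge_min lexx.
- by move=> x /KA/phi1 h; exact: min_l.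
- by move=> x h; apply: phiK => p0; apply: h; rewrite p0 min_r.
Qed.

End Bump.

Section HittingCompact.
Variables (R : realType) (G : topologicalGroupType) (L : set G).
Local Notation bG := (borelG G).
Local Notation Om := (borel_hull L).
Hypothesis hG : hausdorff_space G.
Variable U : nat -> set G.
Hypotheses (Uo : forall j, open (U j))
  (Us : forall (P : Om) j x y, pts P x -> pts P y -> U j x -> U j y -> x = y)
  (Uc : forall x, exists j, U j x).

(** The events of missing the sets of a compact exhaustion decrease to the event
that [P] is empty, which is null because [nu] is proper. *)
Lemma exists_hitting_compact (nu : probability Om R) (F : nat -> set G) (e : R) :
  nu [set P : Om | pts P = set0] = 0%E -> (forall n, compact (F n)) ->
  nondecreasing_seq F -> \bigcup_n F n = setT -> 0 < e ->
  exists K, compact K /\ (nu (~` hits K) < e%:E)%E.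
Proof.
move=> nu0 cF ndF covF e0.
have mh n : measurable (~` hits (L := L) (F n)).
  by apply: measurableC; apply: (measurable_hits Uo Us Uc); exact: compact_borelG.
have e1 : \bigcap_n ~` hits (L := L) (F n) = [set P | pts P = set0].
  rewrite -setC_bigcup -hits_bigcup covF; apply/seteqP; split=> P.
    move=> h; apply: contrapT => /eqP/set0P[x Px]; apply: h; by exists x.
  by move=> /= P0 [x []]; rewrite P0.
have : nu \o (fun n => ~` hits (L := L) (F n)) @ \oo --> nu (\bigcap_n ~` hits (L := L) (F n)).
  apply: nonincreasing_cvg_mu => //.
  - by apply: le_lt_trans (probability_le1 _ (mh 0%N)) _; rewrite ltry.
  - exact: bigcap_measurableType.
  - move=> m n mn; apply/subsetPset; apply: subsetC => P [x [Px Fx]].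
    by exists x; split => //; have /subsetPset := ndF _ _ mn; exact.
rewrite e1 nu0 => h.
have n0 : nbhs (0 : \bar R)%E [set x : \bar R | (x < e%:E)%E].
  by apply: open_ereal_lt'; rewrite lte_fin.
by have [n _ hn] := h _ n0; exists (F n); split => //; exact: hn n (leqnn n).
Qed.

End HittingCompact.

(** * Counting points *)
Section Counting.
Variables (R : realType) (G : topologicalGroupType) (L : set G).
Hypotheses (hG : hausdorff_space G) (lG : locally_compact [set: G]).
Hypotheses (dL : uniformly_discrete L) (aL : approximate_subgroup L).
Local Notation Om := (borel_hull L).

(** Translating [X] by the inverse of one of its points in [C] moves [X & C] into
a fixed set. *)
Lemma cnt_bounded (S X C : set G) (N : R) :
  invmul X `<=` S -> cnt (R := R) (S `&` invmul C) = N%:E ->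
  0 <= N -> (cnt (X `&` C) <= N%:E)%E.
Proof.
move=> XS cN N0; have [XC0|/set0P[y [Xy Cy]]] := eqVneq (X `&` C) set0.
  by rewrite XC0 /cnt esum_set0 lee_fin.
rewrite -cN -(@cnt_image R _ _ (fun x => y^-1 * x)%g); last first.
  by move=> x z _ _; exact: mulgI.
apply: cntS => _ [x [Xx Cx] <-].
have h Z : Z y -> Z x -> invmul Z (y^-1 * x)%g by move=> Zy Zx; apply/invmulP; exists y, x.
by split; [apply: XS; exact: h|exact: h].
Qed.

Lemma locally_finite_cnt (S C : set G) : locally_finite S -> compact C ->
  exists2 N : R, 0 <= N & cnt (S `&` invmul C) = N%:E.
Proof.
move=> Sf cC; exists (fine (cnt (S `&` invmul C))).
  by apply: fine_ge0; exact: cnt_ge0.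
rewrite fineK// ge0_fin_numE ?cnt_ge0//; apply: cnt_finite; apply: Sf.
exact: compact_invmul.
Qed.

Lemma cnt_hull (C : set G) : compact C -> exists2 N : R, 0 <= N &
  forall P : Om, (cnt (pts P `&` C) <= N%:E)%E.
Proof.
move=> cC; have [N N0 NE] := locally_finite_cnt (locally_finite_approx2 dL aL) cC.
exists N => // P; apply: (cnt_bounded _ NE N0).
exact: (@ext_hull_approx G L hG lG dL aL P).
Qed.

(** For [P] in the hull, [(P L)^-1 (P L) <= L (P^-1 P) L <= L L L L]. *)
Lemma cnt_hull_mul (C : set G) : compact C -> exists2 N : R, 0 <= N &
  forall P : Om, (cnt (mulgset (pts P) L `&` C) <= N%:E)%E.
Proof.
move=> cC; have [N N0 NE] := locally_finite_cnt (locally_finite_approx4 dL aL) cC.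
exists N => // P; apply: (cnt_bounded _ NE N0) => z.
move=> /invmulP[_ [_ [[x Px [l Ll <-]] [y Py [k Lk <-]] ->]]].
have : invmul (pts P) (x^-1 * y)%g by apply/invmulP; exists x, y.
move=> /(ext_hull_approx hG lG dL aL)[a La [b Lb ab]].
exists (l^-1 * a)%g; first by exists l^-1%g; [exact: approxV|exists a].
exists (b * k)%g; first by exists b => //; exists k.
by rewrite invgM -!mulgA (mulgA a) ab -mulgA.
Qed.

End Counting.

(** * An almost invariant vector *)
Section AlmostInvariant.
Variables (R : realType) (G : topologicalGroupType) (L : set G).
Local Notation bG := (borelG G).
Local Notation Om := (borel_hull L).
Hypothesis sG : @second_countable G.
Variable U : nat -> set G.
Hypotheses (Uo : forall j, open (U j))
  (Us : forall (P : Om) j x y, pts P x -> pts P y -> U j x -> U j y -> x = y)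
  (Uc : forall x, exists j, U j x).
Variables (H Hm : set G).
Hypotheses (Hgrp : is_subgroup H) (mHm : measurable (Hm : set bG))
  (HmE : forall (P : Om) x y, pts P x -> pts P y -> Hm (x^-1 * y)%g <-> H (x^-1 * y)%g).
Variable nu : probability Om R.
Hypothesis nu_inv : forall (g : G) (A : set Om), measurable A ->
    nu (act g @^-1` A) = nu A.

Local Notation "x ~~ y" := (H (x^-1 * y)%g) (at level 70).
Local Notation cmu := (campbell Uo Us Uc nu).
Local Notation lead := (lead (L := L) U H).
Local Notation sqn := (sqn Uo Us Uc Hm nu).

Lemma sqnE (w : Om * bG -> R) : measurable_fun setT w ->
  sqn w = (\int[nu]_P \esum_(x in lead P) (w (P, x) ^+ 2)%:E)%E.
Proof.
move=> mw; rewrite /sqn /sqint.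
rewrite (class_integral sG Uo Us Uc mHm HmE nu (h := fun z => (w z ^+ 2)%:E))//.
  by apply/measurable_EFinP; exact: measurable_funX.
by move=> z; rewrite lee_fin sqr_ge0.
Qed.

Lemma sqn_le (w : Om * bG -> R) (b : Om -> \bar R) : measurable_fun setT w -> measurable_fun setT b ->
  (forall P, \esum_(x in lead P) (w (P, x) ^+ 2)%:E <= b P)%E ->
  (sqn w <= \int[nu]_P b P)%E.
Proof.
move=> mw mb wb; rewrite sqnE//; apply: ge0_le_integral => //.
- by move=> P _; apply: esum_ge0 => x _; rewrite lee_fin sqr_ge0.
- apply: (measurable_esum_lead sG Uo Us Uc mHm HmE (h := fun z => (w z ^+ 2)%:E)).
    by apply/measurable_EFinP; exact: measurable_funX.
  by move=> z; rewrite lee_fin sqr_ge0.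
Qed.

(** If [w] vanishes on the classes that miss [C], at most [N] classes of each [P]
contribute to the norm. *)
Lemma sqn_bound (w : Om * bG -> R) (C : set G) (c N : R) : measurable_fun setT w -> 0 <= c ->
  (forall P : Om, cnt (pts P `&` C) <= N%:E)%E ->
  (forall (P : Om) x, pts P x -> `|w (P, x)| <= c) ->
  (forall (P : Om) x, pts P x -> w (P, x) <> 0 -> exists y, [/\ pts P y, x ~~ y & C y]) ->
  (sqn w <= (c ^+ 2 * N)%:E)%E.
Proof.
move=> mw c0 CN wc wC.
have -> : (c ^+ 2 * N)%:E = (\int[nu]_P (c ^+ 2 * N)%:E)%E.
  by rewrite integral_cst//; transitivity ((c ^+ 2 * N)%:E * 1)%E; [rewrite mule1|congr (_ * _)%E; rewrite -(probability_setT nu)].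
apply: sqn_le => // P.
pose i y : \bar R := (\1_C y)%:E.
have i0 y : (0 <= i y)%E by rewrite lee_fin.
apply: (@le_trans _ _ (\esum_(x in lead P)
    ((c ^+ 2)%:E * \esum_(y in [set y | pts P y /\ x ~~ y]) i y))%E).
  apply: le_esum => x [Px _]; have [->|/eqP w0] := eqVneq (w (P, x)) 0.
    by rewrite expr0n/= mule_ge0 ?lee_fin ?sqr_ge0// esum_ge0.
  have [y [Py xy Cy]] := wC P x Px w0.
  apply: (@le_trans _ _ ((c ^+ 2)%:E * 1)%E).
    rewrite mule1 lee_fin -[w _ ^+ 2]real_normK ?num_real//.
    by rewrite ler_pXn2r ?nnegrE// wc.
  rewrite lee_wpmul2l ?lee_fin ?sqr_ge0//.
  apply: (@le_trans _ _ (\esum_(z in [set y]) i z)%E).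
    by rewrite esum_set1// /i indicE mem_set.
  by apply: esum_subset => // _ ->.
rewrite -(esum_regroup Us Uc Hgrp (h := fun=> c ^+ 2))//; last first.
  by move=> _; rewrite sqr_ge0.
rewrite -esumZl ?sqr_ge0// [X in (_ <= X)%E]EFinM lee_wpmul2l ?lee_fin ?sqr_ge0//.
apply: le_trans (CN P); rewrite /cnt esum_mkcondr le_esum// => x _.
by rewrite /i indicE; case: ifP.
Qed.

Variables (phi : G -> R) (K' : set G).
Hypotheses (cphi : continuous phi) (phi0 : forall x, 0 <= phi x)
  (phi1 : forall x, phi x <= 1) (phiK : forall x, phi x <> 0 -> K' x).

(** The supremum of [phi] over the class of a point, taken along the cells so that
it is measurable. Cells without a point of the class contribute 0, which is
harmless as [phi] is nonnegative. *)
Definition class_term j (z : Om * bG) : R :=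
  phi (sel U j z.1) * \1_(link U Hm j) z.

Definition class_max (z : Om * bG) : R := sups (class_term ^~ z) 0.

Lemma class_term_ubound z : ubound (range (class_term ^~ z)) 1.
Proof.
move=> _ [j _ <-]; rewrite /class_term indicE.
by case: (_ \in _); rewrite ?mulr1 ?mulr0.
Qed.

Lemma measurable_class_max : measurable_fun setT class_max.
Proof.
apply: measurable_fun_sups => [z _|j].
  by exists 1; exact: class_term_ubound.
apply: measurable_funM; last exact: measurable_indic (measurable_link sG Uo Us Uc mHm _).
have mphi : measurable_fun setT (phi : bG -> R).
  apply: (measurability _ (RGenOInfty.measurableE R)) => _ [_ [a ->] <-].
  rewrite setTI; apply: (@open_borelG G).
  by apply: open_comp => [x _|]; [exact: cphi|exact: interval_open].
apply: (measurableT_comp mphi).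
by apply: (@measurableT_comp _ _ _ _ _ _ (sel U j) _ fst) => //; exact: measurable_sel.
Qed.

Lemma class_max_ge (P : Om) x y : pts P x -> pts P y -> x ~~ y ->
  phi y <= class_max (P, x).
Proof.
move=> Px Py xy; have [j yj] := cell_cover Uc y.
apply: (@le_trans _ _ (class_term j (P, x))).
  rewrite /class_term indicE mem_set ?mulr1 ?(selE Us Py yj)//.
  exact/(linkP Us HmE Px Py yj).
by apply: ub_le_sup; [exists 1 => _ [i _ <-]; apply: class_term_ubound; exists i|exists j].
Qed.

Lemma class_max_le (P : Om) x t : 0 <= t -> pts P x ->
  (forall y, pts P y -> x ~~ y -> phi y <= t) -> class_max (P, x) <= t.
Proof.
move=> t0 Px h; apply: ge_sup; first by exists (class_term 0 (P, x)); exists 0%N.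
move=> _ [j _ <-]; rewrite /class_term indicE.
case: (boolP (_ \in _)) => [/set_mem lj|_]; last by rewrite mulr0.
by rewrite mulr1; have [Py xy] := link_sel HmE Px lj; exact: h.
Qed.

Lemma class_max_ge0 (P : Om) x : pts P x -> 0 <= class_max (P, x).
Proof. by move=> Px; apply: le_trans (phi0 x) (class_max_ge Px Px (class_refl Hgrp x)). Qed.

Lemma class_max_le1 (P : Om) x : pts P x -> class_max (P, x) <= 1.
Proof. by move=> Px; apply: class_max_le. Qed.

Lemma class_max_inv : class_inv H class_max.
Proof.
have le (P : Om) x y : pts P x -> pts P y -> x ~~ y -> class_max (P, x) <= class_max (P, y).
  move=> Px Py xy; apply: class_max_le => // [|z Pz xz]; first exact: class_max_ge0.
  apply: class_max_ge => //; apply: (class_trans Hgrp _ xz).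
  exact: class_sym.
move=> P x y Px Py xy; apply/eqP; rewrite eq_le !le//.
exact: class_sym.
Qed.

Lemma pts_actV g (P : Om) x : pts (act g^-1%g P) x <-> pts P (g * x)%g.
Proof.
rewrite pts_act; split=> [[y Py <-]|Px]; first by rewrite mulVKg.
by exists (g * x)%g => //; rewrite mulKg.
Qed.

Lemma class_shift (g x y : G) : ((g^-1 * x)^-1 * (g^-1 * y) = x^-1 * y)%g.
Proof. by rewrite invgM -mulgA mulKg. Qed.

Lemma gact_max_ge g (P : Om) x y : pts P x -> pts P y -> x ~~ y ->
  phi (g^-1 * y)%g <= gact g class_max (P, x).
Proof.
move=> Px Py xy; apply: class_max_ge; rewrite ?class_shift//.
  by apply/pts_actV; rewrite mulVKg.
by apply/pts_actV; rewrite mulVKg.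
Qed.

Lemma gact_max_le g (P : Om) x t : 0 <= t -> pts P x ->
  (forall y, pts P y -> x ~~ y -> phi (g^-1 * y)%g <= t) -> gact g class_max (P, x) <= t.
Proof.
move=> t0 Px h; apply: class_max_le => //.
  by apply/pts_actV; rewrite mulVKg.
move=> y /pts_actV Py; rewrite -{1}(mulKg g y) class_shift => xy.
by rewrite -(mulKg g y); exact: h.
Qed.

Lemma gact_max_ge0 g (P : Om) x : pts P x -> 0 <= gact g class_max (P, x).
Proof.
by move=> Px; apply: le_trans (phi0 _) (gact_max_ge g Px Px (class_refl Hgrp x)).
Qed.

Lemma gact_max_le1 g (P : Om) x : pts P x -> gact g class_max (P, x) <= 1.
Proof. by move=> Px; apply: gact_max_le. Qed.

Lemma gact_max_neq0 g (P : Om) x : pts P x -> gact g class_max (P, x) <> 0 ->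
  exists y, [/\ pts P y, x ~~ y & K' (g^-1 * y)%g].
Proof.
move=> Px n0; apply: contrapT => h; apply: n0; apply/eqP.
rewrite eq_le gact_max_ge0// andbT; apply: gact_max_le => // y Py xy.
have [->//|/eqP/phiK Ky] := eqVneq (phi (g^-1 * y)%g) 0.
by case: h; exists y.
Qed.

Lemma gact_max_dist g (P : Om) x d : 0 <= d -> pts P x ->
  (forall y, `|phi (g^-1 * y)%g - phi y| <= d) ->
  `|gact g class_max (P, x) - class_max (P, x)| <= d.
Proof.
move=> d0 Px h; rewrite ler_distl; apply/andP; split.
  rewrite lerBlDr; apply: class_max_le => // [|y Py xy].
    by rewrite addr_ge0// gact_max_ge0.
  apply: le_trans (_ : phi (g^-1 * y)%g + d <= _); last by rewrite lerD2r gact_max_ge.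
  by have := h y; rewrite ler_distl lerBlDr => /andP[].
apply: gact_max_le => // [|y Py xy]; first by rewrite addr_ge0// class_max_ge0.
apply: le_trans (_ : phi y + d <= _); last by rewrite lerD2r class_max_ge.
by have := h y; rewrite ler_distl => /andP[].
Qed.

Lemma sub_max_neq0 g (P : Om) x : pts P x ->
  gact g class_max (P, x) - class_max (P, x) <> 0 ->
  exists y, [/\ pts P y, x ~~ y & K' y \/ K' (g^-1 * y)%g].
Proof.
move=> Px n0; have [g0|/eqP] := eqVneq (gact g class_max (P, x)) 0; last first.
  by move=> /(gact_max_neq0 Px)[y [Py xy Ky]]; exists y; split => //; right.
have : gact 1%g class_max (P, x) <> 0.
  by rewrite gact1 => c0; apply: n0; rewrite g0 c0 subr0.
move=> /(gact_max_neq0 Px)[y [Py xy]]; rewrite invg1 mul1g => Ky.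
by exists y; split => //; left.
Qed.

Hypotheses (hG : hausdorff_space G) (lG : locally_compact [set: G]).
Hypotheses (dL : uniformly_discrete L) (aL : approximate_subgroup L).
Hypothesis cK' : compact K'.

(** A continuous function with compact support is uniformly continuous: for [g] in
[V] both terms vanish outside the compact set [V K']. *)
Lemma phi_uniform (V : set G) (d : R) : compact V -> nbhs 1%g V -> 0 < d ->
  \forall g \near (1%g : G), forall y, `|phi (g^-1 * y)%g - phi y| <= d.
Proof.
move=> cV nV d0; have V1 : V 1%g := nbhs_singleton nV.
have cC : compact (mulgset V K') by exact: compact_mulgset.
have h : \forall g \near (1%g : G), forall y, mulgset V K' y ->
    `|phi (g^-1 * y)%g - phi y| <= d.
  move/compact_near_coveringP : cC => /(_ G (nbhs (1%g : G))
    (fun g y => `|phi (g^-1 * y)%g - phi y| <= d)); apply => y _.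
  have c : continuous (fun z : G * G => phi (z.2^-1 * z.1)%g - phi z.1).
    move=> z; apply: cvgB; last first.
      by apply: (@continuous_comp _ _ _ fst phi); [exact: cvg_fst|exact: cphi].
    apply: (@continuous_comp _ _ _ (fun z : G * G => (z.2^-1 * z.1)%g) phi); last exact: cphi.
    apply: (@continuous_comp _ _ _ (fun z : G * G => (z.2, z.1)) (fun z : G * G => (z.1^-1 * z.2)%g)).
      by apply: cvg_pair; [exact: cvg_snd|exact: cvg_fst].
    exact: invmulg_continuous.
  have := c (y, 1%g); rewrite /continuous_at /= invg1 mul1g subrr => /cvgrPdist_le/(_ d d0).
  by under eq_near => z do rewrite sub0r normrN.
near=> g.
have Vg : V g by near: g.
have hg : forall y, mulgset V K' y -> `|phi (g^-1 * y)%g - phi y| <= d by near: g.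
move=> y; have [/hg//|nC] := pselect (mulgset V K' y).
have [->|/eqP/phiK Ky] := eqVneq (phi (g^-1 * y)%g) 0; last first.
  by case: nC; exists g => //; exists (g^-1 * y)%g => //; rewrite mulVKg.
have [->|/eqP/phiK Ky] := eqVneq (phi y) 0; first by rewrite subr0 normr0 ltW.
by case: nC; exists 1%g => //; exists y => //; rewrite mul1g.
Unshelve. all: by end_near. Qed.

(** By [phi_uniform], a small translation changes [class_max] by at most [d], and
only on the classes that meet a fixed compact set; [sqn_bound] concludes. *)
Lemma class_max_vector : is_vector Uo Us Uc H Hm nu class_max.
Proof.
have [V nV [cV _]] := compact_nbhs lG (1%g : G).
have V1 : V 1%g := nbhs_singleton nV.
split.
- split; first exact: measurable_class_max.
  have [N N0 CN] := @cnt_hull R G L hG lG dL aL K' cK'.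
  apply: le_lt_trans (_ : ((1 ^+ 2 * N)%:E < +oo)%E); last exact: ltry.
  apply: (sqn_bound (C := K')) => //; first exact: measurable_class_max.
    by move=> P x Px; rewrite ger0_norm ?class_max_ge0 ?class_max_le1.
  move=> P x Px; rewrite -{1}(gact1 class_max) => /(gact_max_neq0 Px).
  by rewrite invg1 => -[y [Py xy]]; rewrite mul1g => Ky; exists y.
- exact: class_max_inv.
- move=> e e0.
  have cC : compact (mulgset V K') by exact: compact_mulgset.
  have [N N0 CN] := @cnt_hull R G L hG lG dL aL _ cC.
  pose d := Num.min 1 (e / (N + 1)).
  have N1 : 0 < N + 1 by rewrite ltr_wpDl.
  have d0 : 0 < d by rewrite lt_min ltr01 divr_gt0.
  near=> g.
  have Vg : V g by near: g.
  have hg : forall y, `|phi (g^-1 * y)%g - phi y| <= d.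
    by near: g; exact: phi_uniform cV nV d0.
  apply: le_trans (_ : ((d ^+ 2 * N)%:E <= _)%E).
    apply: (sqn_bound (C := mulgset V K')) => //.
    + apply: measurable_funB; last exact: measurable_class_max.
      by apply: measurable_gact; exact: measurable_class_max.
    + exact: ltW.
    + by move=> P x Px; apply: gact_max_dist => //; exact: ltW.
    + move=> P x Px /(sub_max_neq0 Px)[y [Py xy Ky]]; exists y; split => //.
      case: Ky => Ky; first by exists 1%g => //; exists y => //; rewrite mul1g.
      by exists g => //; exists (g^-1 * y)%g => //; rewrite mulVKg.
  have d1 : d <= 1 by rewrite /d ge_min lexx.
  have de : d <= e / (N + 1) by rewrite /d ge_min lexx orbT.
  rewrite lee_fin; apply: (@le_trans _ _ (d * N)).
    by rewrite ler_wpM2r// expr2 ler_piMl// ltW.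
  apply: (@le_trans _ _ (e / (N + 1) * N)); first by rewrite ler_wpM2r.
  by rewrite mulrAC ler_pdivrMr// ler_wpM2l ?ltW// ltrDl.
Unshelve. all: by end_near. Qed.

Lemma esum_le1 (A : set G) (f : G -> R) : (forall x, 0 <= f x) ->
  (forall x, A x -> f x <= 1) ->
  (forall x y, A x -> A y -> f x <> 0 -> f y <> 0 -> x = y) ->
  (\esum_(x in A) (f x)%:E <= 1)%E.
Proof.
move=> f0 f1 fu; have [[x [Ax nx]]|h] := pselect (exists x, A x /\ f x <> 0); last first.
  rewrite esum1// => x Ax; congr (_%:E); apply: contrapT => nx; apply: h.
  by exists x.
have -> : (\esum_(x in A) (f x)%:E = \esum_(x in [set x]) (f x)%:E)%E.
  rewrite esum_mkcond [RHS]esum_mkcond; apply: eq_esum => y _.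
  have [->|yx] := eqVneq y x; first by rewrite !mem_set.
  rewrite [in RHS]memNset; last by move=> /= e; rewrite e eqxx in yx.
  case: ifPn => // /set_mem Ay; congr (_%:E); apply: contrapT => ny.
  by rewrite (fu y x) ?eqxx in yx.
by rewrite esum_set1 ?lee_fin// f1.
Qed.

Variable (K : set G).
Hypotheses (mK : measurable (K : set bG)) (phiK1 : forall x, K x -> phi x = 1).

Lemma hits_translate g : hits (L := L) (translate g K) = act g^-1%g @^-1` hits K.
Proof.
apply/seteqP; split=> P.
  move=> [y [Py [x Kx e]]]; exists x; split => //; apply/pts_actV.
  by rewrite e.
move=> [x [/pts_actV Px Kx]]; exists (g * x)%g; split => //; by exists x.
Qed.

(** If [P] has a point in [K], the value of [class_max] on its class is 1. *)
Lemma sqn_class_max_ge : (nu (hits K) <= sqn class_max)%E.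
Proof.
have mh := measurable_hits Uo Us Uc mK.
rewrite sqnE; last exact: measurable_class_max.
rewrite -(setIT (hits K)) -(integral_indic nu measurableT mh).
apply: ge0_le_integral => //.
- exact/measurable_EFinP/measurable_indic.
- apply: (measurable_esum_lead sG Uo Us Uc mHm HmE (h := fun z => (class_max z ^+ 2)%:E)).
    by apply/measurable_EFinP/measurable_funX; exact: measurable_class_max.
  by move=> z; rewrite lee_fin sqr_ge0.
move=> P _; rewrite indicE; case: (boolP (P \in _)) => [/set_mem[y [Py Ky]]|_]; last first.
  by apply: esum_ge0 => x _; rewrite lee_fin sqr_ge0.
have [_ /(_ y Py)[x lx yx] _] := lead_transversal Us Uc Hgrp P.
have [Px _] := lx.
apply: (@le_trans _ _ (\esum_(z in [set x]) (class_max (P, z) ^+ 2)%:E)%E).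
  rewrite esum_set1 ?lee_fin ?sqr_ge0// expr_ge1 ?class_max_ge0//.
  by rewrite -(phiK1 Ky) class_max_ge//; exact: class_sym.
apply: esum_subset => [_ ->//|z]; by rewrite lee_fin sqr_ge0.
Qed.

Variable M : set G.
Hypothesis HM : forall (P : Om) x y, pts P x -> pts P y -> M x -> M y -> x ~~ y.
Hypothesis K'M : K' `<=` M.

(** Outside the exceptional event, [P] has points in [K] and in [g K]. All the
points of [P] in [M] lie in one class; on this class both [class_max] and its
translate take their maximal value 1, and on the other classes both vanish. On
the exceptional event at most one class contributes, and at most 1. *)
Lemma sqn_almost_invariant g : translate g K' `<=` M ->
  (sqn (gact g class_max - class_max)%R <= 2%:E * nu (~` hits K))%E.
Proof.
move=> gK'M; have mh := measurable_hits Uo Us Uc mK.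
have mhg : measurable (hits (L := L) (translate g K)).
  by rewrite hits_translate -[X in measurable X]setTI; exact: measurable_act.
have KK' x : K x -> K' x by move=> Kx; apply: phiK; rewrite phiK1//; exact/eqP/oner_neq0.
have mC : measurable (~` hits K `|` ~` hits (L := L) (translate g K)).
  by apply: measurableU; exact: measurableC.
have mw := measurable_class_max.
apply: (@le_trans _ _ (nu (~` hits K `|` ~` hits (L := L) (translate g K)))); last first.
  apply: le_trans (measureU2 _ (measurableC mh) (measurableC mhg)) _.
  rewrite hits_translate.
  rewrite mule_natl mule2n; apply: leeD => //; rewrite le_eqVlt; apply/orP; left.
  by apply/eqP; exact: nu_inv g^-1%g _ (measurableC mh).
rewrite -(setIT (_ `|` _)) -(integral_indic nu measurableT mC).
have nM P x : pts P x -> gact g class_max (P, x) - class_max (P, x) <> 0 ->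
    exists y, [/\ pts P y, x ~~ y & M y].
  move=> Px /(sub_max_neq0 Px)[y [Py xy Ky]]; exists y; split => //.
  case: Ky => [/K'M//|Ky]; apply: gK'M; exists (g^-1 * y)%g => //.
  by rewrite mulVKg.
apply: sqn_le.
- by apply: measurable_funB => //; exact: measurable_gact.
- exact/measurable_EFinP/measurable_indic.
move=> P; rewrite indicE; case: (boolP (P \in _)) => [_|].
  apply: esum_le1 => [x|x [Px _]|x y lx ly].
  - exact: sqr_ge0.
  - rewrite -real_normK ?num_real// expr_le1//.
    change (`|gact g class_max (P, x) - class_max (P, x)| <= 1).
    rewrite ler_distl; apply/andP; split.
      by rewrite lerBlDr (le_trans (class_max_le1 Px))// lerDr gact_max_ge0.
    by rewrite (le_trans (gact_max_le1 g Px))// lerDr class_max_ge0.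
  - have [Px _] := lx; have [Py _] := ly.
    move=> /eqP; rewrite sqrf_eq0 => /eqP/(nM P x Px)[x' [Px' xx' Mx']].
    move=> /eqP; rewrite sqrf_eq0 => /eqP/(nM P y Py)[y' [Py' yy' My']].
    have [_ _] := lead_transversal Us Uc Hgrp P; apply => //.
    apply: (class_trans Hgrp xx'); apply: (class_trans Hgrp (HM Px' Py' Mx' My')).
    exact: class_sym.
move=> /negP h; rewrite esum1// => x [Px _]; congr (_%:E).
suff -> : (gact g class_max - class_max)%R (P, x) = 0 by rewrite expr0n.
change (gact g class_max (P, x) - class_max (P, x) = 0).
apply: contrapT => n0; have [z [Pz xz Mz]] := nM P x Px n0; apply: n0.
have [y [Py Ky]] : hits K P.
  by apply: contrapT => nh; apply: h; apply/mem_set; left.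
have [y' [Py' [k Kk e]]] : hits (translate g K) P.
  by apply: contrapT => nh; apply: h; apply/mem_set; right.
have My : M y by apply/K'M/KK'.
have My' : M y' by apply: gK'M; exists k => //; exact: KK'.
have xy : x ~~ y := class_trans Hgrp xz (HM Pz Py Mz My).
have xy' : x ~~ y' := class_trans Hgrp xz (HM Pz Py' Mz My').
have c1 : class_max (P, x) = 1.
  by apply/eqP; rewrite eq_le class_max_le1//= -(phiK1 Ky) class_max_ge.
have g1 : gact g class_max (P, x) = 1.
  apply/eqP; rewrite eq_le gact_max_le1//= -(phiK1 Kk) -(mulKg g k) e.
  exact: gact_max_ge.
by rewrite c1 g1 subrr.
Qed.

End AlmostInvariant.

(** * The measure attached to an invariant vector *)
Section InvariantVector.
Variables (R : realType) (G : topologicalGroupType) (L : set G).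
Local Notation bG := (borelG G).
Local Notation Om := (borel_hull L).
Hypotheses (hG : hausdorff_space G) (lG : locally_compact [set: G]).
Hypothesis sG : @second_countable G.
Hypotheses (dL : uniformly_discrete L) (aL : approximate_subgroup L).
Variable U : nat -> set G.
Hypotheses (Uo : forall j, open (U j))
  (Us : forall (P : Om) j x y, pts P x -> pts P y -> U j x -> U j y -> x = y)
  (Uc : forall x, exists j, U j x).
Variables (H Hm : set G).
Hypotheses (Hgrp : is_subgroup H) (mHm : measurable (Hm : set bG))
  (HmE : forall (P : Om) x y, pts P x -> pts P y -> Hm (x^-1 * y)%g <-> H (x^-1 * y)%g).
Variable nu : probability Om R.
Hypothesis nu_inv : forall (g : G) (A : set Om), measurable A ->
    nu (act g @^-1` A) = nu A.

Local Notation "x ~~ y" := (H (x^-1 * y)%g) (at level 70).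
Local Notation cmu := (campbell Uo Us Uc nu).
Local Notation lead := (lead (L := L) U H).
Local Notation sqn := (sqn Uo Us Uc Hm nu).

Variable w : Om * bG -> R.
Hypotheses (mw : measurable_fun setT w) (wi : class_inv H w) (wfin : (sqn w < +oo)%E)
  (w_fixed : forall g, (sqn (gact g w - w)%R = 0)%E).

Let sqw (z : Om * bG) : \bar R := (w z ^+ 2)%:E.
Let sqw0 z : (0 <= sqw z)%E. Proof. by rewrite lee_fin sqr_ge0. Qed.
Let msqw : measurable_fun setT sqw.
Proof. by apply/measurable_EFinP; exact: measurable_funX. Qed.

(** Integrating over the Campbell measure makes sigma-additivity immediate; the
form as a mean of sums over the points of [P] in [A] is [wmassE]. *)
Definition wmass (A : set bG) : \bar R := (\int[cmu]_(z in snd @^-1` A) sqw z)%E.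

Let msnd (A : set bG) : measurable A -> measurable (snd @^-1` A : set (Om * bG)).
Proof. by move=> mA; rewrite -[X in measurable X]setTI; apply: measurable_snd. Qed.

Lemma wmass0 : wmass set0 = 0%E.
Proof. by rewrite /wmass preimage_set0 integral_set0. Qed.

Lemma wmass_ge0 A : (0 <= wmass A)%E.
Proof. exact: integral_ge0. Qed.

Lemma wmass_sigma_additive : semi_sigma_additive wmass.
Proof.
move=> F mF tF mUF; rewrite /wmass preimage_bigcup.
apply: (@semi_sigma_additive_nng_induced _ _ _ cmu sqw msqw sqw0 (fun n => snd @^-1` F n)).
- by move=> n; exact: msnd.
- by move=> i j _ _ [z [Fi Fj]]; apply: tF => //; exists z.2.
- by rewrite -preimage_bigcup; exact: msnd.
Qed.

HB.instance Definition _ := isMeasure.Build _ _ R wmass wmass0 wmass_ge0 wmass_sigma_additive.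

Definition wterm (A : set bG) (z : Om * bG) : \bar R := (sqw z * (\1_A z.2)%:E)%E.

Lemma wterm_ge0 A z : (0 <= wterm A z)%E.
Proof. by rewrite mule_ge0// lee_fin. Qed.

Lemma measurable_wterm A : measurable A -> measurable_fun setT (wterm A).
Proof.
move=> mA; apply: emeasurable_funM => //; apply/measurable_EFinP.
apply: (@measurableT_comp _ _ _ _ _ _ (\1_A : bG -> R) _ snd) => //.
Qed.

Lemma wmassE A : measurable A ->
  wmass A = (\int[nu]_P \esum_(x in pts P) wterm A (P, x))%E.
Proof.
move=> mA; rewrite -(campbell_integral Uo Us Uc nu (measurable_wterm mA) (wterm_ge0 A)).
rewrite /wmass integral_mkcond; apply: eq_integral => z _.
rewrite patchE /wterm indicE; have -> : (z \in snd @^-1` A) = (z.2 \in A).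
  by apply/idP/idP => /set_mem h; exact/mem_set.
by case: ifP => _; rewrite ?mule1 ?mule0.
Qed.

Lemma sqn_wE : sqn w = (\int[nu]_P \esum_(x in lead P) sqw (P, x))%E.
Proof. exact: (sqnE sG Uo Us Uc mHm HmE nu). Qed.

(** Invariance of [w] in norm gives equality almost everywhere on the leading
points. *)
Lemma fixed_ae g : ae_eq nu setT
  (fun P => \esum_(x in lead P) ((gact g w - w)%R (P, x) ^+ 2)%:E)%E (cst 0%E).
Proof.
have md : measurable_fun setT (gact g w - w).
  by apply: measurable_funB => //; exact: measurable_gact.
apply/(ae_eq_integral_abs nu measurableT).
  apply: (measurable_esum_lead sG Uo Us Uc mHm HmE (h := fun z => ((gact g w - w)%R z ^+ 2)%:E)).
    by apply/measurable_EFinP; exact: measurable_funX.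
  by move=> z; rewrite lee_fin sqr_ge0.
rewrite -(w_fixed g) (sqnE sG Uo Us Uc mHm HmE nu md).
apply: eq_integral => P _; rewrite gee0_abs//.
by apply: esum_ge0 => x _; rewrite lee_fin sqr_ge0.
Qed.

(** Replacing [P] by [g P] does not change the mean, and almost surely [w (g P,
g x) = w (P, x)] at every point [x] of [P], by invariance on the leading points
and constancy on the classes. *)
Lemma wmass_mull g (A : set bG) : measurable A ->
  wmass ((fun x : bG => (g * (x : G))%g) @^-1` A) = wmass A.
Proof.
move=> mA.
have mgA : measurable ((fun x : bG => (g * (x : G))%g : bG) @^-1` A).
  rewrite -[X in measurable X]setTI.
  by apply: (@continuous_borelG G (fun x => g * x)%g) => //; exact: mulgl_continuous.
rewrite !wmassE//.
pose W (B : set bG) P := (\esum_(x in pts P) wterm B (P, x))%E.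
have mW B : measurable B -> measurable_fun setT (W B).
  move=> mB; apply: (measurable_esum_pts Uo Us Uc); first exact: measurable_wterm.
  exact: wterm_ge0.
have W0 B P : (0 <= W B P)%E by apply: esum_ge0 => x _; exact: wterm_ge0.
rewrite -(nu_integral_act nu_inv g (mW _ mA) (W0 A)).
apply: ge0_ae_eq_integral => //.
- exact: mW.
- exact: (measurableT_comp (mW _ mA) (@measurable_act G L g)).
- by move=> P _; exact: (W0 _ P).
apply: filterS (fixed_ae g^-1%g) => P /= /(_ I) h _.
rewrite /W pts_act /translate esum_image; last by move=> x y _ _; exact: mulgI.
apply: eq_esum => x Px.
have [_ /(_ x Px)[y ly xy] _] := lead_transversal Us Uc Hgrp P.
have [Py _] := ly.
have e : (gact g^-1%g w - w)%R (P, x) = 0.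
  rewrite (class_invB (class_inv_gact _ wi) wi Px Py xy).
  apply/eqP; rewrite -sqrf_eq0 -eqe eq_le [X in _ && X]lee_fin sqr_ge0 andbT.
  pose d z : \bar R := ((gact g^-1%g w - w)%R (P, z) ^+ 2)%:E.
  have d0 z : (0 <= d z)%E by rewrite lee_fin sqr_ge0.
  apply: (@le_trans _ _ (\esum_(z in lead P) d z)%E); last by rewrite /d h.
  rewrite -/(d y) -(@esum_set1 _ _ y d)//.
  by apply: esum_subset => // _ ->.
rewrite /wterm /sqw /=; congr (_%:E * _)%E; congr (_ ^+ 2).
move/eqP : e; rewrite subr_eq0 => /eqP <-; by rewrite /gact /= invgK.
Qed.

(** For [x], [x'] in one class, [x (l i) = x' (l j)] forces [l i (l j)^-1] into
[H]. So the points [x (l k)] in [A], with [x] in one class of [P] and [k < n],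
are distinct points of [P L] in [A], at most [N] in number. Each class is thus
counted at most [N] times with the weight [w ^+ 2]. *)
Lemma wmass_packing n (l : nat -> G) (A : set bG) (N : R) : measurable A -> 0 <= N ->
  (forall k, (k < n)%N -> L (l k)) ->
  (forall i j, (i < n)%N -> (j < n)%N -> H (l i * (l j)^-1)%g -> i = j) ->
  (forall P : Om, (cnt (mulgset (pts P) L `&` (A : set G)) <= N%:E)%E) ->
  (\sum_(k < n) wmass ((fun x : bG => ((x : G) * l k)%g) @^-1` A) <= N%:E * sqn w)%E.
Proof.
move=> mA N0 Ll lH AN.
pose Al k : set bG := (fun x : bG => ((x : G) * l k)%g : bG) @^-1` A.
have mAl k : measurable (Al k).
  rewrite /Al -[X in measurable X]setTI.
  by apply: (@continuous_borelG G (fun x => x * l k)%g) => //; exact: mulgr_continuous.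
under eq_bigr => k _ do rewrite (wmassE (mAl k)).
have mT k : measurable_fun setT (fun P : Om => \esum_(x in pts P) wterm (Al k) (P, x))%E.
  by apply: (measurable_esum_pts Uo Us Uc); [exact: measurable_wterm|exact: wterm_ge0].
have T0 k (P : Om) : (0 <= \esum_(x in pts P) wterm (Al k) (P, x))%E.
  by apply: esum_ge0 => x _; exact: wterm_ge0.
rewrite -(ge0_integral_sum nu measurableT (f := fun (k : 'I_n) P => \esum_(x in pts P) wterm (Al k) (P, x))%E)//.
have mL : measurable_fun setT (fun P => \esum_(x in lead P) sqw (P, x))%E.
  exact: (measurable_esum_lead sG Uo Us Uc mHm HmE).
rewrite sqn_wE -(ge0_integralZl_EFin nu measurableT)//; last first.
  by move=> P _; apply: esum_ge0.
apply: ge0_le_integral => //.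
- by move=> P _; apply: sume_ge0 => k _; exact: T0.
- exact: emeasurable_sum.
- exact: measurable_funeM.
move=> P _; rewrite -esum_sum; last by move=> *; exact: wterm_ge0.
pose c x : \bar R := (\sum_(k < n) (\1_(Al k) x)%:E)%E.
have c0 x : (0 <= c x)%E by apply: sume_ge0 => k _; rewrite lee_fin.
have -> : (\esum_(x in pts P) \sum_(k < n) wterm (Al k) (P, x) =
    \esum_(x in pts P) ((w (P, x) ^+ 2)%:E * c x))%E.
  by apply: eq_esum => x _; rewrite /c ge0_sume_distrr//.
rewrite (esum_regroup Us Uc Hgrp (h := fun x => w (P, x) ^+ 2))//; last 2 first.
- by move=> x; exact: sqr_ge0.
- by move=> x y Px Py xy; rewrite (wi Px Py xy).
rewrite esumZl//; apply: le_esum => y ly.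
rewrite muleC lee_wpmul2r ?sqw0//.
apply: le_trans (AN P).
pose J := [set x | pts P x /\ y ~~ x].
have cE x : c x = (\esum_(k in `I_n) (\1_A (x * l k)%g)%:E)%E.
  rewrite esum_fset//.
  rewrite -fsbig_ord; apply: eq_bigr => k _; rewrite !indicE.
  by congr ((nat_of_bool _)%:R%:E); apply/idP/idP => /set_mem h; exact/mem_set.
under eq_esum => x _ do rewrite cE.
rewrite esum_esum; last by move=> *; rewrite lee_fin.
rewrite -(@esum_image _ _ _ (J `*`` fun=> `I_n) (fun k => (k.1 * l k.2)%g : G)
  (fun z => (\1_A z)%:E)); last first.
  move=> [x i] [x' j] /set_mem[/= [Px yx] ni] /set_mem[/= [Px' yx'] nj] /= e.
  have ij : i = j.
    apply: lH => //; have -> : (l i * (l j)^-1 = x^-1 * x')%g.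
      by rewrite -(mulKg x (l i)) e -mulgA mulgK.
    by apply: (class_trans Hgrp _ yx'); exact: class_sym.
  by move: e; rewrite ij => /mulIg ->.
rewrite /cnt esum_mkcondr esum_mkcond [leRHS]esum_mkcond; apply: le_esum => z _.
case: ifPn => [/set_mem[[x k] [/= [Px _] nk] <-]|_]; last by case: ifP => // _; case: ifP.
rewrite mem_set; first by rewrite indicE; case: (_ \in A).
by exists x => //; exists (l k) => //; exact: Ll.
Qed.

(** The case of a single coset of [wmass_packing]. *)
Lemma wmass_compact (C : set G) : compact C -> (wmass C < +oo)%E.
Proof.
move=> cC; have [N N0 CN] := @cnt_hull_mul R G L hG lG dL aL C cC.
have mC : measurable (C : set bG) by exact: compact_borelG.
apply: le_lt_trans (_ : (N%:E * sqn w < +oo)%E); last first.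
  by rewrite lte_mul_pinfty ?lee_fin.
have := @wmass_packing 1 (fun=> 1%g) C N mC N0 (fun _ _ => approx1 aL) _ CN.
rewrite big_ord1; under eq_fun do rewrite mulg1.
by apply => -[] // [].
Qed.

Lemma wmass_setT : (sqn w <= wmass setT)%E.
Proof.
rewrite wmassE// sqn_wE; apply: ge0_le_integral => //.
- by move=> P _; apply: esum_ge0.
- exact: (measurable_esum_lead sG Uo Us Uc mHm HmE).
- by apply: (measurable_esum_pts Uo Us Uc); [exact: measurable_wterm|exact: wterm_ge0].
move=> P _; under [leRHS]eq_esum => x _ do rewrite /wterm indicE in_setT mule1.
by apply: esum_subset => // x [].
Qed.

Lemma wmass_sigma_finite : exists2 m : {sigma_finite_measure set bG -> \bar R},
  (forall A, m A = wmass A) & exists2 A : set G, compact A & (0 < sqn w -> 0 < m A)%E.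
Proof.
have [K [cK ndK covK]] : exists K : nat -> set G,
  [/\ forall n, compact (K n), nondecreasing_seq K & \bigcup_n K n = setT].
  by apply: compact_exhaustion; split.
have mK n : measurable (K n : set bG) by exact: compact_borelG.
have sf : sigma_finite setT wmass.
  by exists K => // n; split => //; exact: wmass_compact.
pose S := Measure_isSigmaFinite.Build _ _ _ wmass sf.
pose m : {sigma_finite_measure set bG -> \bar R} := HB.pack wmass S.
exists m => //; apply: contrapT => h.
have K0 n : wmass (K n) = 0%E.
  apply: contrapT => n0; apply: h; exists (K n) => // _.
  by rewrite lt_neqAle wmass_ge0 andbT eq_sym; exact/eqP.
have : m \o K @ \oo --> m (\bigcup_n K n).
  by apply: nondecreasing_cvg_mu => //; exact: bigcup_measurable.
rewrite covK (_ : m \o K = cst 0%E); last by apply/funext => n; exact: K0.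
move=> /(cvg_lim (@ereal_hausdorff R)); rewrite lim_cst// => m0.
apply: h; exists (K 0%N) => // w0; have := lt_le_trans w0 wmass_setT.
by rewrite -[wmass setT]/(m setT) -m0 ltxx.
Qed.

Hypothesis w0 : (0 < sqn w)%E.

(** On [L] the masses [m (Al k)] are bounded above by [C0]. As [m (Al k) * m (Al
k^-1) = a ^+ 2] and [k^-1] is in [L] too, they are bounded below by [a ^+ 2 /
(C0 + 1)]; the packing inequality then bounds [n]. *)
Lemma coset_bound : exists n0 : nat, forall n (l : nat -> G),
  (forall k, (k < n)%N -> L (l k)) ->
  (forall i j, (i < n)%N -> (j < n)%N -> H (l i * (l j)^-1)%g -> i = j) -> (n <= n0)%N.
Proof.
have [m mE [A cA /(_ w0) mA0]] := wmass_sigma_finite.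
have m_inv (g : G) (B : set bG) : measurable B ->
    m ((fun x : bG => (g * (x : G))%g) @^-1` B) = m B.
  by move=> mB; rewrite !mE; exact: wmass_mull.
have m_cpt (C : set G) : compact C -> (m C < +oo)%E by rewrite mE; exact: wmass_compact.
have mA : measurable (A : set bG) by exact: compact_borelG.
have [N N0 AN] := @cnt_hull_mul R G L hG lG dL aL A cA.
pose Al (k : G) : set bG := (fun x : bG => ((x : G) * k)%g : bG) @^-1` A.
have sE : (fine (sqn w))%:E = sqn w by rewrite fineK// ge0_fin_numE// ltW.
pose C0 := N * fine (sqn w).
have C00 : 0 <= C0 by rewrite mulr_ge0// fine_ge0// ltW.
have pack n l : (forall k, (k < n)%N -> L (l k)) ->
    (forall i j, (i < n)%N -> (j < n)%N -> H (l i * (l j)^-1)%g -> i = j) ->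
    (\sum_(k < n) m (Al (l k)) <= C0%:E)%E.
  move=> Ll lH; rewrite EFinM sE; under eq_bigr do rewrite mE.
  exact: wmass_packing mA N0 Ll lH AN.
have one k : L k -> (m (Al k) <= C0%:E)%E.
  by move=> Lk; have := pack 1%N (fun=> k); rewrite big_ord1; apply => // -[] // [].
have fin k : L k -> m (Al k) = (fine (m (Al k)))%:E.
  by move=> Lk; rewrite fineK// ge0_fin_numE// (le_lt_trans (one k Lk))// ltry.
have AE : m A = (fine (m A))%:E by rewrite fineK// ge0_fin_numE// m_cpt.
set a := fine (m A) in AE.
have a0 : 0 < a by rewrite -lte_fin -AE.
have low k : L k -> a ^+ 2 / (C0 + 1) <= fine (m (Al k)).
  move=> Lk; have Lk' : L k^-1%g := approxV aL Lk.
  have := haar_mulrV sG m_inv k hG cA m_cpt mA0.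
  rewrite -/(Al k) -/(Al k^-1%g) (fin k Lk) (fin _ Lk') AE -!EFinM => -[e].
  have := one _ Lk'; rewrite (fin _ Lk') lee_fin => le1.
  rewrite ler_pdivrMr ?ltr_wpDl// expr2 -e ler_wpM2l ?fine_ge0//.
  by rewrite (le_trans le1)// lerDl.
pose t := C0 * (C0 + 1) / a ^+ 2.
exists (Num.bound t) => n l Ll lH.
have := pack n l Ll lH.
have -> : (\sum_(k < n) m (Al (l k)) = (\sum_(k < n) fine (m (Al (l k))))%:E)%E.
  by rewrite -sumEFin; apply: eq_bigr => k _; apply: fin; exact: Ll.
rewrite lee_fin => le2.
have {le2} : n%:R * (a ^+ 2 / (C0 + 1)) <= C0.
  apply: le_trans le2; rewrite -[n in n%:R]card_ord -sum1_card natr_sum mulr_suml.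
  by apply: ler_sum => k _; rewrite mul1r; apply: low; exact: Ll.
rewrite mulrA ler_pdivrMr ?ltr_wpDl// -ler_pdivlMr ?exprn_gt0// => le3.
rewrite -(ler_nat R); apply: (le_trans le3); apply: ltW; apply: archi_boundP.
by rewrite divr_ge0 ?sqr_ge0// mulr_ge0// addr_ge0.
Qed.

(** A family of representatives of distinct cosets of maximal size meets every
coset of an element of [L]. *)
Lemma finitely_many_cosets : exists F : set G, [/\ finite_set F, F `<=` L &
  forall x, L x -> exists2 f, F f & H (x * f^-1)%g].
Proof.
have [n0 hn0] := coset_bound.
pose Q n := `[< exists l : nat -> G, (forall k, (k < n)%N -> L (l k)) /\
  (forall i j, (i < n)%N -> (j < n)%N -> H (l i * (l j)^-1)%g -> i = j) >].
have Qn n : Q n -> (n <= n0)%N by move=> /asboolP[l [Ll lH]]; exact: hn0 Ll lH.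
have Q0 : exists n, Q n by exists 0%N; apply/asboolP; exists (fun=> 1%g).
case: (ex_maxnP Q0 Qn) => n /asboolP[l [Ll lH]] nmax.
exists (l @` `I_n); split; first by apply: finite_image; exact: finite_II.
  by move=> _ [k kn <-]; exact: Ll.
move=> x Lx; apply: contrapT => h.
have nx i : (i < n)%N -> ~ H (x * (l i)^-1)%g.
  by move=> ni hx; apply: h; exists (l i) => //; exists i.
suff /nmax : Q n.+1 by rewrite ltnn.
apply/asboolP; exists (fun k => if k == n then x else l k); split.
  by move=> k; case: eqVneq => // kn; rewrite ltnS leq_eqVlt (negPf kn) => /Ll.
move=> i j; case: eqVneq => [->|ni]; case: eqVneq => [->|nj] //.
- by move=> _; rewrite ltnS leq_eqVlt (negPf nj) => /nx.
- rewrite ltnS leq_eqVlt (negPf ni) => /nx hx _ hi; case: hx.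
  by case: Hgrp => _ _ /(_ _ hi); rewrite invgM invgK.
- by rewrite !ltnS [(i <= n)%N]leq_eqVlt [(j <= n)%N]leq_eqVlt (negPf ni) (negPf nj); exact: lH.
Qed.

End InvariantVector.

(** * Finite generation *)
Lemma subgroup_generated_is_subgroup (G : groupType) (X : set G) :
  is_subgroup (subgroup_generated X).
Proof.
split.
- by move=> K [[K1 _ _] _].
- by move=> x y hx hy K [sK XK]; have [_ Km _] := sK; apply: Km; [apply: hx|apply: hy].
- by move=> x hx K [sK XK]; have [_ _ Ki] := sK; apply: Ki; apply: hx.
Qed.

Lemma sub_subgroup_generated (G : groupType) (X : set G) : X `<=` subgroup_generated X.
Proof. exact: sub_smallest. Qed.

Lemma subgroup_generated_min (G : groupType) (X K : set G) :
  is_subgroup K -> X `<=` K -> subgroup_generated X `<=` K.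
Proof. by move=> sK XK; exact: smallest_sub. Qed.

Theorem theorem5 (R : realType) (G : topologicalGroupType) (L : set G)
  (lcscG : lcsc_group G) (TG : property_T R G) (latL : star_approximate_lattice R L) :
  finitely_generated (subgroup_generated L).
Proof.
have [hG lG sG] := lcscG.
have [dL aL [nu [nu_proper nu_inv]]] := latL.
have [Q [eps [cQ eps0 TQ]]] := property_T_orthogonal TG.
have [U [Uo Us Ucov]] := small_open_cover lcscG dL.
have LL (P : borel_hull L) : invmul (pts P) `<=` mulgset L L.
  exact: (@ext_hull_approx G L hG lG dL aL P).
have Us' (P : borel_hull L) j x y : pts P x -> pts P y -> U j x -> U j y -> x = y.
  move=> Px Py Ux Uy; apply: (Us j) => //; rewrite (invmul_approx aL).
  by apply: (LL P); apply/invmulP; exists x, y.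
have [F [cF ndF covF]] := compact_exhaustion lcscG.
(* If [K] is missed with probability below [e], the vector has squared norm above
   1/2, and the Kazhdan set displaces it by a squared norm below
   [2 e <= eps / 2]. *)
pose e := Num.min (2^-1) (eps / 4).
have e0 : 0 < e by rewrite lt_min invr_gt0 ltr0n divr_gt0.
have [K [cK nuK]] := exists_hitting_compact hG Uo Us' Ucov nu_proper cF ndF covF e0.
have [phi [K' [cK' cphi phiI phi1 phiK']]] := bump_function R hG lG cK.
(* [M] contains the support of [phi] and its translates by the Kazhdan set. *)
pose M := K' `|` mulgset Q K'.
have cM : compact M by apply: compactU => //; exact: compact_mulgset.
pose S0 := mulgset L L `&` invmul M.
have S0fin : finite_set S0.
  by apply: (locally_finite_approx2 dL aL); exact: compact_invmul.
pose H := subgroup_generated S0.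
have Hgrp : is_subgroup H by exact: subgroup_generated_is_subgroup.
(* [H] itself need not be closed; its part in [L L] is locally finite, hence
   closed, and contains every [x^-1 y] in [H] with [x], [y] in a member of the
   hull. *)
pose Hm := H `&` mulgset L L.
have mHm : measurable (Hm : set (borelG G)).
  apply: closed_borelG; apply: locally_finite_closed => //.
  apply: (@locally_finiteS G Hm (mulgset L L)); first by move=> x [].
  exact: locally_finite_approx2.
have HmE (P : borel_hull L) x y : pts P x -> pts P y ->
    Hm (x^-1 * y)%g <-> H (x^-1 * y)%g.
  move=> Px Py; split=> [[]//|hxy]; split => //; apply: (LL P).
  by apply/invmulP; exists x, y.
have HM (P : borel_hull L) x y : pts P x -> pts P y -> M x -> M y -> H (x^-1 * y)%g.
  move=> Px Py Mx My; apply: sub_subgroup_generated; split.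
    by apply: (LL P); apply/invmulP; exists x, y.
  by apply/invmulP; exists x, y.
have phi0 x : 0 <= phi x by case/andP : (phiI x).
have phile1 x : phi x <= 1 by case/andP : (phiI x).
have mK : measurable (K : set (borelG G)) by exact: compact_borelG.
have mh : measurable (hits (L := L) K) by exact: (measurable_hits Uo Us' Ucov).
pose u := class_max (L := L) U Hm phi.
have u_vec : is_vector Uo Us' Ucov H Hm nu u.
  exact: (class_max_vector sG Uo Us' Ucov Hgrp mHm HmE nu cphi phi0 phile1 phiK' hG lG dL aL cK').
have u_ge : (nu (hits K) <= sqn Uo Us' Ucov Hm nu u)%E.
  exact: (sqn_class_max_ge sG Uo Us' Ucov Hgrp mHm HmE nu cphi phi0 phile1 mK phi1).
have nuKE : (nu (hits K) = 1 - nu (~` hits K))%E.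
  by rewrite -{1}[hits K]setCK (probability_setC nu (measurableC mh)).
have u_half : ((2^-1)%:E < sqn Uo Us' Ucov Hm nu u)%E.
  apply: lt_le_trans u_ge; rewrite nuKE.
  have fin : nu (~` hits K) \is a fin_num by rewrite fin_num_measure//; exact: measurableC.
  have : (nu (~` hits K) < (2^-1)%:E)%E.
    by apply: lt_le_trans nuK _; rewrite lee_fin /e ge_min lexx.
  by rewrite -(fineK fin) lte_fin -EFinB lte_fin => ?; lra.
have [w [w_vec w0 w_fixed]] : exists w, [/\ is_vector Uo Us' Ucov H Hm nu w,
    (0 < sqn Uo Us' Ucov Hm nu w)%E &
    forall g, sqn Uo Us' Ucov Hm nu (gact g w - w)%R = 0%E].
  have T := property_T_vector sG (Uo := Uo) (Us := Us') (Uc := Ucov) Hgrp mHm HmE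
    (nu := nu) nu_inv TQ u_vec.
  apply: T.
    by apply: lt_trans u_half; rewrite lte_fin.
  move=> g Qg.
  have gM : translate g K' `<=` M by move=> _ [x Kx <-]; right; exists g => //; exists x.
  apply: le_lt_trans (sqn_almost_invariant sG Uo Us' Ucov Hgrp mHm HmE nu_inv cphi phi0
    phile1 phiK' mK phi1 HM (@subsetUl _ K' _) gM) _.
  apply: (@lt_trans _ _ (eps%:E * (2^-1)%:E)%E); last by rewrite lte_pmul2l.
  apply: (@lt_le_trans _ _ (2%:E * e%:E)%E); first by rewrite lte_pmul2l.
  rewrite -!EFinM lee_fin; apply: (@le_trans _ _ (2 * (eps / 4))).
    by rewrite ler_pM2l// /e ge_min lexx orbT.
  by rewrite le_eqVlt; apply/orP; left; apply/eqP; field.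
have [[mw wfin] wi _] := w_vec.
have [F0 [F0fin F0L F0H]] := finitely_many_cosets hG lG sG dL aL Hgrp mHm HmE nu_inv mw wi wfin w_fixed w0.
exists (S0 `|` F0); first by rewrite finite_setU.
have LsubL := @sub_subgroup_generated _ L.
have sL := @subgroup_generated_is_subgroup _ L.
have sF := @subgroup_generated_is_subgroup _ (S0 `|` F0).
apply/seteqP; split; apply: subgroup_generated_min => //.
  move=> x [[[a La [b Lb <-]] _]|/F0L/LsubL//].
  by have [_ sM _] := sL; apply: sM; exact: LsubL.
move=> x Lx; have [f Ff hf] := F0H x Lx.
rewrite -(mulgVK f x); have [_ sM _] := sF; apply: sM.
  apply: (subgroup_generated_min sF _ hf) => y S0y.
  by apply: sub_subgroup_generated; left.
by apply: sub_subgroup_generated; right.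
Qed.
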